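(* Let $\Omega\subset\mathbb{R}^n$, let $\Sigma\subset\mathcal{P}(\Omega)$ be a $\sigma$-algebra and let $\sigma:\Sigma\to\mathbb{R}$ be a $\sigma$-measure. Then for every $u^*\in \left(L^\infty(\Omega,\Sigma,\sigma)\right)^*$ there exist a unique pure $\mu_p\in\mathrm{ba}(\Omega,\Sigma,\sigma)$ and a unique $h\in L^1(\Omega,\Sigma,\sigma)$ such that $$\langle u^*, f\rangle = \int_\Omega f h\, d\sigma + \int_\Omega f\, d\mu_p$$ for every $f\in L^\infty(\Omega,\Sigma,\sigma)$.
   Context: A measure on $\Sigma$ is a finitely additive function $\mu:\Sigma\to\mathbb{R}$; a $\sigma$-measure is a countably additive one. $\mathrm{ba}(\Omega,\Sigma)$ is the set of bounded measures on $\Sigma$ and $\mathrm{ca}(\Omega,\Sigma)$ the set of bounded $\sigma$-measures. $\mathrm{ba}(\Omega,\Sigma)$ is a vector lattice with the setwise order; $|\mu|$ denotes the total variation, and $(\mu\wedge\nu)(A)=\inf\{\mu(A')+\nu(A\setminus A'):A'\in\Sigma, A'\subset A\}$. A measure $\mu\in\mathrm{ba}(\Omega,\Sigma)$ is pure if $|\mu|\wedge|\nu|=0$ for all $\nu\in\mathrm{ca}(\Omega,\Sigma)$. $\mathrm{ba}(\Omega,\Sigma,\sigma)$ is the set of $\mu\in\mathrm{ba}(\Omega,\Sigma)$ that are weakly absolutely continuous with respect to $\sigma$, i.e. $|\sigma|(A)=0$ implies $\mu(A)=0$ for all $A\in\Sigma$. Integration with respect to a finitely additive $\mu$: let $|\mu|^*(B)=\inf\{|\mu|(A):A\in\Sigma,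 B\subset A\}$. Functions $f_k$ converge to $f$ in measure $\mu$ if $|\mu|^*\{|f_k-f|>\varepsilon\}\to0$ for every $\varepsilon>0$. $f:\Omega\to\mathbb{R}$ is $\mu$-measurable if it is the limit in measure of simple functions. $f$ is $\mu$-integrable if there are integrable simple functions $s_k\to f$ in measure $\mu$ with $\int_\Omega|s_k-s_l|\,d|\mu|\to0$ as $k,l\to\infty$, and then $\int_\Omega f\,d\mu:=\lim_k\int_\Omega s_k\,d\mu$. $L^1(\Omega,\Sigma,\sigma)$ and $L^\infty(\Omega,\Sigma,\sigma)$ are the usual spaces of $\sigma$-a.e. equivalence classes of functions that are $\sigma$-integrable, respectively $\sigma$-measurable and essentially bounded (with respect to $|\sigma|$). $L^\infty(\Omega,\Sigma,\sigma)$ carries the essential supremum norm, and $(\cdot)^*$ denotes the topological dual. *)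

(* Defs.v *)
From HB Require Import structures.
From mathcomp Require Import all_boot all_order all_algebra.
From mathcomp Require Import all_classical all_reals all_analysis.

Set Implicit Arguments.
Unset Strict Implicit.
Unset Printing Implicit Defensive.

Import Order.TTheory GRing.Theory Num.Theory.
Import numFieldNormedType.Exports.

Local Open Scope classical_set_scope.
Local Open Scope ring_scope.
Local Open Scope quotient_scope.

(* A family Sigma of subsets of an arbitrary (possibly empty) type T is used
   instead of a measurableType, because the latter has to be pointed.  A set
   function mu : set T -> R only matters through its values on Sigma. *)
Section measures.
Context {R : realType} {T : Type}.
Variable Sigma : set (set T).
Implicit Types (mu nu : set T -> R) (m : set T -> \bar R) (A B N : set T)
  (f g : T -> R).

Definition fin_additive mu := forall A B, Sigma A -> Sigma B ->
  A `&` B = set0 -> mu (A `|` B) = mu A + mu B.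

Definition countably_additive mu := forall F : (set T)^nat,
  (forall i, Sigma (F i)) -> trivIset setT F ->
  series (mu \o F) @ \oo --> mu (\bigcup_i F i).

Definition sigma_measure mu := fin_additive mu /\ countably_additive mu.

Definition bounded_on_Sigma mu := exists M : R, forall A, Sigma A -> `|mu A| <= M.

Definition ba mu := fin_additive mu /\ bounded_on_Sigma mu.

Definition ca mu := sigma_measure mu /\ bounded_on_Sigma mu.

Definition variation mu A : \bar R := ereal_sup
  [set x | exists k (F : 'I_k -> set T),
     [/\ forall i, Sigma (F i) /\ F i `<=` A, trivIset setT F &
         x = (\sum_(i < k) `|mu (F i)|)%:E]].

Definition meas_meet m1 m2 A : \bar R := ereal_inf
  [set (m1 B + m2 (A `\` B))%E | B in [set B | Sigma B /\ B `<=` A]].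

Definition pure mu := ba mu /\ forall nu, ca nu ->
  forall A, Sigma A -> meas_meet (variation mu) (variation nu) A = 0%E.

Definition weakly_ac mu sigma :=
  forall A, Sigma A -> variation sigma A = 0%E -> mu A = 0.

Definition ba_wrt sigma mu := ba mu /\ weakly_ac mu sigma.

Definition outer_variation mu B : \bar R :=
  ereal_inf [set variation mu A | A in [set A | Sigma A /\ B `<=` A]].

Definition cvg_in_measure mu (F : (T -> R)^nat) f := forall e : R, 0 < e ->
  outer_variation mu [set x | e < `|F k x - f x|] @[k --> \oo] --> 0%E.

Definition simple f :=
  finite_set (range f) /\ forall y, Sigma (f @^-1` [set y]).

Definition mu_measurable mu f := exists F : (T -> R)^nat,
  (forall k, simple (F k)) /\ cvg_in_measure mu F f.

Definition simple_integrable mu f :=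
  simple f /\ forall y, y != 0 -> (variation mu (f @^-1` [set y]) < +oo)%E.

Definition determining_seq mu (F : (T -> R)^nat) f :=
  [/\ forall k, simple_integrable mu (F k), cvg_in_measure mu F f &
      sintegral (variation mu) (fun x => `|F kl.1 x - F kl.2 x|)
        @[kl --> (\oo, \oo)] --> 0%E].

Definition mu_integrable mu f := exists F, determining_seq mu F f.

(* The limit does not depend on the determining sequence; the value is 0 when
   f is not integrable. *)
Definition mu_integral mu f : R := xget 0
  [set v | exists2 F, determining_seq mu F f &
     sintegral (EFin \o mu) (F k) @[k --> \oo] --> v%:E].

Definition null mu N :=
  exists A, [/\ Sigma A, variation mu A = 0%E & N `<=` A].

Definition ae_equal mu f g := null mu [set x | f x <> g x].

Definition ess_bounded mu f := exists M : R, null mu [set x | M < `|f x|].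

(* The infimum runs over nonnegative bounds so that it is 0 if mu = 0. *)
Definition ess_norm mu f : R :=
  inf [set M : R | 0 <= M /\ null mu [set x | M < `|f x|]].

End measures.

Section sigma_algebra_facts.
Context {R : realType} {T : Type}.
Variables (Sigma : set (set T)) (hS : sigma_algebra setT Sigma).
Implicit Types (A B N : set T) (f g : T -> R) (mu : set T -> R).

Let S0 : Sigma set0. Proof. by case: hS. Qed.

Let SC A : Sigma A -> Sigma (~` A).
Proof. by case: hS => _ + _ => /[apply]; rewrite setTD. Qed.

Let Sbigcup (F : (set T)^nat) : (forall i, Sigma (F i)) -> Sigma (\bigcup_i F i).
Proof. by case: hS => _ _; apply. Qed.

Let SU A B : Sigma A -> Sigma B -> Sigma (A `|` B).
Proof.
move=> hA hB; rewrite -bigcup2E; apply: Sbigcup => i.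
by rewrite /bigcup2; case: ifP => // _; case: ifP.
Qed.

Let SI A B : Sigma A -> Sigma B -> Sigma (A `&` B).
Proof.
by move=> hA hB; rewrite -[A]setCK -[B]setCK -setCU; apply/SC/SU; apply: SC.
Qed.

Let SD A B : Sigma A -> Sigma B -> Sigma (A `\` B).
Proof. by move=> hA hB; rewrite setDE; apply: SI => //; exact: SC. Qed.


Let Sbigcup_fin (I : choiceType) (D : set I) (F : I -> set T) : finite_set D ->
  (forall i, Sigma (F i)) -> Sigma (\bigcup_(i in D) F i).
Proof.
by move=> /finite_seqP[s ->] hF; rewrite bigcup_seq; apply: big_ind.
Qed.

Lemma simple_cst (c : R) : simple Sigma (fun=> c : R).
Proof.
split; first by apply: (@sub_finite_set _ _ [set c]) => // _ [x _ <-].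
move=> y; have [->|yc] := eqVneq y c.
  by rewrite preimage_cst in_set1/= eqxx -setC0; exact: SC.
by rewrite preimage_cst in_set1/= eq_sym (negbTE yc).
Qed.

Lemma simpleD f g : simple Sigma f -> simple Sigma g -> simple Sigma (f \+ g).
Proof.
move=> [ff Sf] [fg Sg]; split.
  apply: sub_finite_set (finite_image2 (fun a b => a + b) ff fg).
  by move=> _ [x _ <-]; exists (f x); [exists x|exists (g x); [exists x|]].
move=> y; rewrite (_ : _ @^-1` _ = \bigcup_(a in range f)
    (f @^-1` [set a] `&` g @^-1` [set y - a])).
  by apply: Sbigcup_fin => // a; exact: SI.
apply/seteqP; split => [x /= <-|x [a _ [/= -> ->]]].
  by exists (f x); [exists x|split => //=; rewrite addrC addKr].
by rewrite addrC subrK.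
Qed.

Lemma simpleZ (c : R) f : simple Sigma f -> simple Sigma (fun x => c * f x).
Proof.
have [->|c0] := eqVneq c 0.
  by move=> _; under eq_fun do rewrite mul0r; exact: simple_cst.
move=> [ff Sf]; split.
  apply: sub_finite_set (finite_image (fun a => c * a) ff).
  by move=> _ [x _ <-]; exists (f x) => //; exists x.
move=> y; rewrite (_ : _ @^-1` _ = f @^-1` [set c^-1 * y])//.
by apply/seteqP; split => x /= => [<-|->]; rewrite ?mulKf ?mulVKf.
Qed.

Lemma variation_ge0 mu A : (0 <= variation Sigma mu A)%E.
Proof.
apply: ereal_sup_ubound; exists 0%N, (fun=> set0); split => //.
- by case.
- by case.
- by rewrite big_ord0.
Qed.

Lemma le_variation mu A B : A `<=` B ->
  (variation Sigma mu A <= variation Sigma mu B)%E.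
Proof.
move=> AB; apply: ereal_sup_le => _ [k [F [hF tF ->]]].
exists k, F; split => // i; have [? FA] := hF i; split => //.
exact: subset_trans AB.
Qed.

Lemma le_abs_variation mu A B : Sigma B -> B `<=` A ->
  (`|mu B|%:E <= variation Sigma mu A)%E.
Proof.
move=> SB BA; apply: ereal_sup_ubound; exists 1%N, (fun=> B); split => //.
- by move=> i j _ _ _; rewrite !ord1.
- by rewrite big_ord1.
Qed.

Lemma variationU mu A B : fin_additive Sigma mu -> Sigma A ->
  (variation Sigma mu (A `|` B) <=
   variation Sigma mu A + variation Sigma mu B)%E.
Proof.
move=> amu SA; apply: ge_ereal_sup => _ [k [F [hF tF ->]]].
have FE i : mu (F i) = mu (F i `&` A) + mu (F i `\` A).
  have [SF _] := hF i; rewrite -amu ?setUIDK//; [exact: SI|exact: SD|].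
  by rewrite setIDA setIAC setDE -!setIA setICr !setI0.
apply: (@le_trans _ _ ((\sum_(i < k) `|mu (F i `&` A)|)%:E +
                       (\sum_(i < k) `|mu (F i `\` A)|)%:E)%E).
  rewrite -EFinD lee_fin -big_split/=; apply: ler_sum => i _.
  by rewrite FE ler_normD.
apply: leeD; apply: ereal_sup_ubound.
- exists k, (fun i => F i `&` A); split => //.
  + by move=> i; split; [apply: SI => //; exact: (hF i).1|exact: subIsetr].
  + exact: trivIset_setIr.
- exists k, (fun i => F i `\` A); split => //.
  + move=> i; split; first by apply: SD => //; exact: (hF i).1.
    by move=> x [Fx nAx]; case: ((hF i).2 _ Fx).
  + by under eq_fun do rewrite setDE; exact: trivIset_setIr.
Qed.

Lemma outer_variation_ge0 mu A : (0 <= outer_variation Sigma mu A)%E.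
Proof. by apply: le_ereal_inf_tmp => _ [B _ <-]; exact: variation_ge0. Qed.

Lemma outer_variation_lt mu N (e : \bar R) :
  (outer_variation Sigma mu N < e)%E <->
  exists A, [/\ Sigma A, N `<=` A & (variation Sigma mu A < e)%E].
Proof.
split=> [/ereal_inf_lt[_ [A [SA NA] <-] Ae]|[A [SA NA]]]; first by exists A.
by apply: le_lt_trans; apply: ereal_inf_lbound; exists A.
Qed.

Lemma ge0_cvge0P (u : (\bar R)^nat) : (forall k, 0 <= u k)%E ->
  u @ \oo --> 0%E <-> forall e : R, 0 < e -> \forall k \near \oo, (u k < e%:E)%E.
Proof.
move=> u0; split=> [|h].
  move=> /fine_cvgP[ufin /cvgr0Pnorm_lt uc] e e0; near=> k.
  rewrite -[u k]fineK; last by near: k.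
  rewrite lte_fin -[fine _]ger0_norm ?fine_ge0//.
  by near: k; exact: uc.
apply/fine_cvgP; split.
  near=> k; rewrite ge0_fin_numE//.
  by apply: (lt_trans _ (ltry 1)); near: k; exact: h.
apply/cvgr0Pnorm_lt => e e0; near=> k.
have uke : (u k < e%:E)%E by near: k; exact: h.
rewrite /= ger0_norm ?fine_ge0// -lte_fin fineK// ge0_fin_numE//.
exact: lt_trans (ltry e).
Unshelve. all: by end_near. Qed.

Lemma mu_measurableD mu f g : fin_additive Sigma mu ->
  mu_measurable Sigma mu f -> mu_measurable Sigma mu g ->
  mu_measurable Sigma mu (f \+ g).
Proof.
move=> amu [F [sF Ff]] [G [sG Gg]]; exists (fun k => F k \+ G k); split.
  by move=> k; exact: simpleD.
move=> e e0; apply/ge0_cvge0P => [k|d d0]; first exact: outer_variation_ge0.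
have e20 : 0 < e / 2 by rewrite divr_gt0.
have d20 : 0 < d / 2 by rewrite divr_gt0.
have /ge0_cvge0P/(_ (d / 2) d20) hF := Ff _ e20.
have /ge0_cvge0P/(_ (d / 2) d20) hG := Gg _ e20.
near=> k.
have /outer_variation_lt[A [SA FA vA]] :
    (outer_variation Sigma mu [set x | (e / 2 < `|F k x - f x|)%R] < (d / 2)%:E)%E.
  by near: k; apply: hF => k; exact: outer_variation_ge0.
have /outer_variation_lt[B [SB GB vB]] :
    (outer_variation Sigma mu [set x | (e / 2 < `|G k x - g x|)%R] < (d / 2)%:E)%E.
  by near: k; apply: hG => k; exact: outer_variation_ge0.
apply/outer_variation_lt; exists (A `|` B); split; first exact: SU.
  move=> x /= ex; have [eF|eF] := ltP (e / 2) `|F k x - f x|.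
    by left; exact: FA.
  right; apply: GB => /=; rewrite ltNge; apply/negP => eG.
  move: ex; rewrite ltNge => /negP; apply.
  rewrite opprD addrACA (le_trans (ler_normD _ _))//.
  by rewrite [leRHS](splitr e) lerD.
apply: le_lt_trans (variationU B amu SA) _.
by rewrite (splitr d) EFinD lteD.
Unshelve. all: by end_near. Qed.

Lemma mu_measurableZ mu (c : R) f :
  mu_measurable Sigma mu f -> mu_measurable Sigma mu (fun x => c * f x).
Proof.
move=> [F [sF Ff]]; exists (fun k x => c * F k x); split.
  by move=> k; exact: simpleZ.
move=> e e0; have c0 : 0 < `|c| + 1 by rewrite ltr_wpDl.
apply/ge0_cvge0P => [k|d d0]; first exact: outer_variation_ge0.
have /ge0_cvge0P/(_ d d0) hF := Ff _ (divr_gt0 e0 c0).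
near=> k.
have /outer_variation_lt[A [SA FA vA]] : (outer_variation Sigma mu
    [set x | (e / (`|c| + 1) < `|F k x - f x|)%R] < d%:E)%E.
  by near: k; apply: hF => k; exact: outer_variation_ge0.
apply/outer_variation_lt; exists A; split => // x /= ex; apply: FA => /=.
rewrite ltr_pdivrMr//; apply: (lt_le_trans ex).
by rewrite -mulrBr normrM mulrC ler_wpM2l// lerDl.
Unshelve. all: by end_near. Qed.

Lemma mu_measurable_cst mu (c : R) : fin_additive Sigma mu ->
  mu_measurable Sigma mu (fun=> c).
Proof.
move=> amu; exists (fun _ _ => c); split; first by move=> _; exact: simple_cst.
move=> e e0; apply/ge0_cvge0P => [k|d d0]; first exact: outer_variation_ge0.
near=> k; apply/outer_variation_lt; exists set0; split => //.
  by move=> x /=; rewrite subrr normr0 ltNge ltW.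
apply: (@le_lt_trans _ _ 0%E); last by rewrite lte_fin.
apply: ge_ereal_sup => _ [m [F [hF tF ->]]]; rewrite lee_fin big1// => i _.
have -> : F i = set0 by apply/seteqP; split => //; exact: (hF i).2.
have := amu set0 set0 S0 S0 (setI0 _).
by rewrite setU0 -[LHS]addr0 => /addrI <-; rewrite normr0.
Unshelve. all: by end_near. Qed.

Section null_sets.
Variable mu : set T -> R.
Hypothesis hmu : sigma_measure Sigma mu.

Lemma variation_eq0P A : variation Sigma mu A = 0%E <->
  forall B, Sigma B -> B `<=` A -> mu B = 0.
Proof.
split=> [A0 B SB BA|A0].
  by have := le_abs_variation mu SB BA; rewrite A0 lee_fin normr_le0 => /eqP.
apply/le_anti; rewrite variation_ge0 andbT.
apply: ge_ereal_sup => _ [k [F [hF _ ->]]].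
by rewrite lee_fin big1// => i _; rewrite A0 ?normr0//; have [] := hF i.
Qed.

Lemma null_subset A B : A `<=` B -> null Sigma mu B -> null Sigma mu A.
Proof.
by move=> AB [C [SC' C0 BC]]; exists C; split => //; exact: subset_trans BC.
Qed.

Lemma null_bigcup (N : (set T)^nat) :
  (forall k, null Sigma mu (N k)) -> null Sigma mu (\bigcup_k N k).
Proof.
move=> /choice[A hA]; exists (\bigcup_k A k); split.
- by apply: Sbigcup => k; have [] := hA k.
- apply/variation_eq0P => B SB BA.
  have SAk k : Sigma (A k) by have [] := hA k.
  have Sfin n : Sigma (\big[setU/set0]_(k < n) A k) by apply: big_ind.
  have -> : B = \bigcup_k (B `&` seqDU A k).
    by rewrite -setI_bigcupr -seqDU_bigcup_eq; apply/esym/setIidPl.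
  have SF k : Sigma (B `&` seqDU A k) by apply: SI => //; exact: SD.
  have tF : trivIset setT (fun k => B `&` seqDU A k).
    by apply: trivIset_setIl; exact: trivIset_seqDU.
  have := hmu.2 _ SF tF.
  have -> : series (mu \o (fun k => B `&` seqDU A k)) = cst 0.
    apply/funext => n; rewrite /series/= big1// => k _.
    have [_ /variation_eq0P Ak0 _] := hA k.
    by apply: Ak0 => // x [_ []].
  by move=> /(cvg_lim (@Rhausdorff R)) <-; rewrite lim_cst//; exact: Rhausdorff.
- by apply: subset_bigcup => k _; have [] := hA k.
Qed.

Lemma null_set0 : null Sigma mu set0.
Proof.
exists set0; split => //; apply/variation_eq0P => B SB; rewrite subset0 => ->.
have := hmu.1 set0 set0 S0 S0 (setI0 _).
by rewrite setU0 -[LHS]addr0 => /addrI.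
Qed.

Lemma nullU A B : null Sigma mu A -> null Sigma mu B -> null Sigma mu (A `|` B).
Proof.
move=> nA nB; rewrite -bigcup2E; apply: null_bigcup => i.
rewrite /bigcup2; case: ifP => // _; case: ifP => // _; exact: null_set0.
Qed.

Lemma ae_equal_refl f : ae_equal Sigma mu f f.
Proof. by apply: null_subset null_set0 => x /=. Qed.

Lemma ae_equal_sym f g : ae_equal Sigma mu f g -> ae_equal Sigma mu g f.
Proof. by apply: null_subset => x /= fg gf; apply: fg. Qed.

Lemma ae_equal_trans f g h :
  ae_equal Sigma mu f g -> ae_equal Sigma mu g h -> ae_equal Sigma mu f h.
Proof.
move=> fg gh; apply: null_subset (nullU fg gh) => x /= fh.
have [fg'|] := eqVneq (f x) (g x); last by move=> /eqP; left.
by right => /=; rewrite -fg'.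
Qed.

Lemma ae_equalD f f' g g' : ae_equal Sigma mu f f' -> ae_equal Sigma mu g g' ->
  ae_equal Sigma mu (f \+ g) (f' \+ g').
Proof.
move=> ff' gg'; apply: null_subset (nullU ff' gg') => x /= h.
have [fE|] := eqVneq (f x) (f' x); last by move=> /eqP; left.
by right => /= gE; apply: h; rewrite fE gE.
Qed.

Lemma ae_equalZ (c : R) f g : ae_equal Sigma mu f g ->
  ae_equal Sigma mu (fun x => c * f x) (fun x => c * g x).
Proof. by apply: null_subset => x /= h fg; apply: h; rewrite fg. Qed.

Lemma ess_boundedD f g : ess_bounded Sigma mu f -> ess_bounded Sigma mu g ->
  ess_bounded Sigma mu (f \+ g).
Proof.
move=> [M nM] [N nN]; exists (M + N); apply: null_subset (nullU nM nN) => x /=.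
move=> h; have [Mf|fM] := ltP M `|f x|; [by left|right => /=].
rewrite ltNge; apply/negP => gN; move: h; rewrite ltNge => /negP; apply.
by rewrite (le_trans (ler_normD _ _))// lerD.
Qed.

Lemma ess_boundedZ (c : R) f : ess_bounded Sigma mu f ->
  ess_bounded Sigma mu (fun x => c * f x).
Proof.
move=> [M nM]; exists (`|c| * M); apply: null_subset nM => x /=.
by rewrite normrM; apply: contraTT; rewrite -!leNgt; exact: ler_wpM2l.
Qed.

Lemma ess_bounded_cst (c : R) : ess_bounded Sigma mu (fun=> c).
Proof.
by exists `|c|; apply: null_subset null_set0 => x /=; rewrite ltxx.
Qed.

Let bnds f := [set M : R | 0 <= M /\ null Sigma mu [set x | M < `|f x|]].

Let bnds_has_inf f : ess_bounded Sigma mu f -> has_inf (bnds f).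
Proof.
move=> [M nM]; split; last by exists 0 => N [].
exists `|M|; split => //; apply: null_subset nM => x /=.
exact/le_lt_trans/ler_norm.
Qed.

Lemma ess_norm_ge0 f : ess_bounded Sigma mu f -> 0 <= ess_norm Sigma mu f.
Proof.
by move=> /bnds_has_inf[fn0 _]; apply: lb_le_inf => // M [].
Qed.

Lemma ess_norm_le f M : 0 <= M -> null Sigma mu [set x | M < `|f x|] ->
  ess_norm Sigma mu f <= M.
Proof. by move=> M0 nM; apply: ge_inf; [exists 0 => N []|]. Qed.

Lemma ess_norm_null f : ess_bounded Sigma mu f ->
  null Sigma mu [set x | ess_norm Sigma mu f < `|f x|].
Proof.
move=> bf.
apply: (@null_subset _
    (\bigcup_k [set x | ess_norm Sigma mu f + k.+1%:R^-1 < `|f x|])).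
  move=> x /= h; have d0 : 0 < `|f x| - ess_norm Sigma mu f by rewrite subr_gt0.
  have [k _ hk] := near_infty_natSinv_lt (PosNum d0).
  by exists k => //=; rewrite -ltrBrDl; exact: (hk k (leqnn k)).
apply: null_bigcup => k; have k0 : 0 < k.+1%:R^-1 :> R by rewrite invr_gt0.
have [M [M0 nM] MltM] := inf_adherent k0 (bnds_has_inf bf).
by apply: null_subset nM => x /=; exact: lt_trans.
Qed.

Lemma ess_normD f g : ess_bounded Sigma mu f -> ess_bounded Sigma mu g ->
  ess_norm Sigma mu (f \+ g) <= ess_norm Sigma mu f + ess_norm Sigma mu g.
Proof.
move=> bf bg; apply: ess_norm_le; first by rewrite addr_ge0// ess_norm_ge0.
apply: null_subset (nullU (ess_norm_null bf) (ess_norm_null bg)) => x /= h.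
have [?|fM] := ltP (ess_norm Sigma mu f) `|f x|; [by left|right => /=].
rewrite ltNge; apply/negP => gN; move: h; rewrite ltNge => /negP; apply.
by rewrite (le_trans (ler_normD _ _))// lerD.
Qed.

Lemma ess_normZ (c : R) f : ess_bounded Sigma mu f ->
  ess_norm Sigma mu (fun x => c * f x) = `|c| * ess_norm Sigma mu f.
Proof.
have leZ (a : R) g : ess_bounded Sigma mu g ->
    ess_norm Sigma mu (fun x => a * g x) <= `|a| * ess_norm Sigma mu g.
  move=> bg; apply: ess_norm_le; first by rewrite mulr_ge0// ess_norm_ge0.
  apply: null_subset (ess_norm_null bg) => x /=.
  by rewrite normrM; apply: contraTT; rewrite -!leNgt; exact: ler_wpM2l.
move=> bf; apply/le_anti; rewrite leZ//=.
have [->|c0] := eqVneq c 0.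
  by rewrite normr0 mul0r ess_norm_ge0//; exact: ess_boundedZ.
rewrite -ler_pdivlMl ?normr_gt0// -normfV.
apply: le_trans (leZ c^-1 _ (ess_boundedZ c bf)).
by rewrite (_ : (fun x => c^-1 * (c * f x)) = f)//; apply/funext => x; rewrite mulKf.
Qed.

Lemma ess_norm_eq0 f : ess_bounded Sigma mu f -> ess_norm Sigma mu f = 0 ->
  ae_equal Sigma mu f (fun=> 0).
Proof.
move=> bf f0; apply: null_subset (ess_norm_null bf) => x /= /eqP.
by rewrite f0 normr_gt0.
Qed.

Lemma ess_norm_ae f g : ess_bounded Sigma mu f -> ess_bounded Sigma mu g ->
  ae_equal Sigma mu f g -> ess_norm Sigma mu f = ess_norm Sigma mu g.
Proof.
have le f' g' : ess_bounded Sigma mu g' -> ae_equal Sigma mu f' g' ->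
    ess_norm Sigma mu f' <= ess_norm Sigma mu g'.
  move=> bg fg; apply: ess_norm_le; first exact: ess_norm_ge0.
  apply: null_subset (nullU fg (ess_norm_null bg)) => x /= h.
  have [fE|] := eqVneq (f' x) (g' x); last by move=> /eqP; left.
  by right; rewrite /= -fE.
by move=> bf bg fg; apply/le_anti; rewrite !le//; exact: ae_equal_sym.
Qed.

End null_sets.
End sigma_algebra_facts.

Section function_spaces.
Context {R : realType} {T : Type} (Sigma : set (set T)) (sigma : set T -> R).

Record L1_fun := MkL1 {
  L1_val :> T -> R ;
  L1_valP : `[< mu_integrable Sigma sigma L1_val >] }.

HB.instance Definition _ := [isSub for L1_val].
HB.instance Definition _ := [Choice of L1_fun by <:].

Record Linfty_fun := MkLinfty {
  Linfty_val :> T -> R ;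
  Linfty_valP : `[< mu_measurable Sigma sigma Linfty_val /\
                    ess_bounded Sigma sigma Linfty_val >] }.

HB.instance Definition _ := [isSub for Linfty_val].
HB.instance Definition _ := [Choice of Linfty_fun by <:].

End function_spaces.

Section quotients.
Context {R : realType} {T : Type}.
Variables (Sigma : set (set T)) (hSigma : sigma_algebra setT Sigma).
Variables (sigma : set T -> R) (hsigma : sigma_measure Sigma sigma).

Section L1.
Local Notation fT := (L1_fun Sigma sigma).

Definition L1_eq (f g : fT) := `[< ae_equal Sigma sigma f g >].

Let L1_refl : reflexive L1_eq.
Proof. by move=> f; apply/asboolP; exact: ae_equal_refl. Qed.

Let L1_sym : symmetric L1_eq.
Proof. by move=> f g; apply/asboolP/asboolP; exact: ae_equal_sym. Qed.

Let L1_trans : transitive L1_eq.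
Proof.
by move=> g f h /asboolP fg /asboolP gh; apply/asboolP/(ae_equal_trans _ _ fg gh).
Qed.

Canonical L1_equiv := EquivRel L1_eq L1_refl L1_sym L1_trans.

Definition L1 : Type := {eq_quot L1_equiv}.

HB.instance Definition _ := Choice.on L1.
HB.instance Definition _ := EqQuotient.on L1.

Definition L1_repr (h : L1) : T -> R := repr h.
Coercion L1_repr : L1 >-> Funclass.

End L1.

Section Linfty.
Local Notation fT := (Linfty_fun Sigma sigma).

Definition Linfty_eq (f g : fT) := `[< ae_equal Sigma sigma f g >].

Let Linfty_refl : reflexive Linfty_eq.
Proof. by move=> f; apply/asboolP; exact: ae_equal_refl. Qed.

Let Linfty_sym : symmetric Linfty_eq.
Proof. by move=> f g; apply/asboolP/asboolP; exact: ae_equal_sym. Qed.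

Let Linfty_trans : transitive Linfty_eq.
Proof.
by move=> g f h /asboolP fg /asboolP gh; apply/asboolP/(ae_equal_trans _ _ fg gh).
Qed.

Canonical Linfty_equiv := EquivRel Linfty_eq Linfty_refl Linfty_sym Linfty_trans.

Definition Linfty : Type := {eq_quot Linfty_equiv}.

HB.instance Definition _ := Choice.on Linfty.
HB.instance Definition _ := EqQuotient.on Linfty.

Definition Linfty_repr (f : Linfty) : T -> R := repr f.
Coercion Linfty_repr : Linfty >-> Funclass.

Lemma Linfty_piP (f g : fT) :
  \pi_Linfty f = \pi_Linfty g <-> ae_equal Sigma sigma f g.
Proof. by split=> [/eqmodP/asboolP|/asboolP fg]; [|apply/eqmodP]. Qed.

Lemma Linfty_repr_pi (f : fT) : ae_equal Sigma sigma (repr (\pi_Linfty f)) f.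
Proof. by apply/Linfty_piP; rewrite reprK. Qed.

Let fbounded (f : fT) : ess_bounded Sigma sigma f.
Proof. by have /asboolP[] := Linfty_valP f. Qed.

Lemma Linfty_cst_subproof (c : R) : `[< mu_measurable Sigma sigma (fun=> c) /\
  ess_bounded Sigma sigma (fun=> c) >].
Proof.
by apply/asboolP; split;
  [exact: mu_measurable_cst hsigma.1|exact: ess_bounded_cst].
Qed.

Lemma LinftyD_subproof (f g : fT) : `[< mu_measurable Sigma sigma (f \+ g) /\
  ess_bounded Sigma sigma (f \+ g) >].
Proof.
have /asboolP[mf bf] := Linfty_valP f; have /asboolP[mg bg] := Linfty_valP g.
by apply/asboolP; split;
  [exact: mu_measurableD hsigma.1 mf mg|exact: ess_boundedD].
Qed.

Lemma LinftyZ_subproof (c : R) (f : fT) :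
  `[< mu_measurable Sigma sigma (fun x => c * f x) /\
      ess_bounded Sigma sigma (fun x => c * f x) >].
Proof.
have /asboolP[mf bf] := Linfty_valP f.
by apply/asboolP; split; [exact: mu_measurableZ|exact: ess_boundedZ].
Qed.

Definition Linfty_fun0 : fT := MkLinfty (Linfty_cst_subproof 0).
Definition Linfty_funD (f g : fT) : fT := MkLinfty (LinftyD_subproof f g).
Definition Linfty_funZ (c : R) (f : fT) : fT := MkLinfty (LinftyZ_subproof c f).

Definition Linfty0 : Linfty := \pi_Linfty Linfty_fun0.
Definition LinftyD (f g : Linfty) : Linfty :=
  \pi_Linfty (Linfty_funD (repr f) (repr g)).
Definition LinftyZ (c : R) (f : Linfty) : Linfty :=
  \pi_Linfty (Linfty_funZ c (repr f)).
Definition LinftyN (f : Linfty) : Linfty := LinftyZ (-1) f.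

Lemma LinftyD_pi (f g : fT) :
  LinftyD (\pi_Linfty f) (\pi_Linfty g) = \pi_Linfty (Linfty_funD f g).
Proof. by apply/Linfty_piP/ae_equalD => //; exact: Linfty_repr_pi. Qed.

Lemma LinftyZ_pi (c : R) (f : fT) :
  LinftyZ c (\pi_Linfty f) = \pi_Linfty (Linfty_funZ c f).
Proof. by apply/Linfty_piP/ae_equalZ => //; exact: Linfty_repr_pi. Qed.

Let fun_eq (f g : fT) : f =1 g -> f = g.
Proof. by move=> fg; apply/val_inj/funext. Qed.

Let LinftyDA : associative LinftyD.
Proof.
move=> f g h; rewrite -[f]reprK -[g]reprK -[h]reprK.
move: (repr f) (repr g) (repr h) => {}f {}g {}h.
rewrite (LinftyD_pi g h) (LinftyD_pi f g) !LinftyD_pi.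
by congr (\pi_Linfty _); apply: fun_eq => x /=; rewrite addrA.
Qed.

Let LinftyDC : commutative LinftyD.
Proof.
move=> f g; rewrite -[f]reprK -[g]reprK !LinftyD_pi.
by congr (\pi_Linfty _); apply: fun_eq => x /=; rewrite addrC.
Qed.

Let Linfty0D : left_id Linfty0 LinftyD.
Proof.
move=> f; rewrite -[f]reprK LinftyD_pi.
by congr (\pi_Linfty _); apply: fun_eq => x /=; rewrite add0r.
Qed.

Let LinftyND : left_inverse Linfty0 LinftyN LinftyD.
Proof.
move=> f; rewrite -[f]reprK; move: (repr f) => {}f.
rewrite /LinftyN (LinftyZ_pi (-1) f) LinftyD_pi.
by congr (\pi_Linfty _); apply: fun_eq => x /=; rewrite mulN1r addNr.
Qed.

HB.instance Definition _ :=
  GRing.isZmodule.Build Linfty LinftyDA LinftyDC Linfty0D LinftyND.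

Let LinftyZA (a b : R) (f : Linfty) :
  LinftyZ a (LinftyZ b f) = LinftyZ (a * b) f.
Proof.
rewrite -[f]reprK; move: (repr f) => {}f; rewrite (LinftyZ_pi b f) !LinftyZ_pi.
by congr (\pi_Linfty _); apply: fun_eq => x /=; rewrite mulrA.
Qed.

Let Linfty1Z : left_id 1 LinftyZ.
Proof.
move=> f; rewrite -[f]reprK !LinftyZ_pi.
by congr (\pi_Linfty _); apply: fun_eq => x /=; rewrite mul1r.
Qed.

Let LinftyZDr : right_distributive LinftyZ +%R.
Proof.
move=> a f g; rewrite -[f]reprK -[g]reprK /GRing.add/=.
move: (repr f) (repr g) => {}f {}g.
rewrite (LinftyD_pi f g) (LinftyZ_pi a f) (LinftyZ_pi a g) LinftyZ_pi LinftyD_pi.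
by congr (\pi_Linfty _); apply: fun_eq => x /=; rewrite mulrDr.
Qed.

Let LinftyZDl (f : Linfty) : {morph LinftyZ^~ f : a b / a + b}.
Proof.
move=> a b; rewrite -[f]reprK [RHS]/GRing.add/=; move: (repr f) => {}f.
rewrite (LinftyZ_pi a f) (LinftyZ_pi b f) LinftyZ_pi LinftyD_pi.
by congr (\pi_Linfty _); apply: fun_eq => x /=; rewrite mulrDl.
Qed.

HB.instance Definition _ := GRing.Zmodule_isLmodule.Build R Linfty
  LinftyZA Linfty1Z LinftyZDr LinftyZDl.

Definition Linfty_norm (f : Linfty) : R := ess_norm Sigma sigma f.

Lemma Linfty_norm_pi (f : fT) :
  Linfty_norm (\pi_Linfty f) = ess_norm Sigma sigma f.
Proof.
apply: (ess_norm_ae hSigma hsigma); [exact: fbounded|exact: fbounded|].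
exact: Linfty_repr_pi.
Qed.

Let ler_Linfty_normD (f g : Linfty) :
  Linfty_norm (f + g) <= Linfty_norm f + Linfty_norm g.
Proof. by rewrite Linfty_norm_pi; apply: ess_normD => //; exact: fbounded. Qed.

Let Linfty_normZ (c : R) (f : Linfty) :
  Linfty_norm (c *: f) = `|c| * Linfty_norm f.
Proof. by rewrite Linfty_norm_pi; apply: ess_normZ => //; exact: fbounded. Qed.

Let Linfty_norm_eq0 (f : Linfty) : Linfty_norm f = 0 -> f = 0.
Proof.
move=> f0; rewrite -[f]reprK; apply/Linfty_piP.
by apply: ess_norm_eq0 => //; exact: fbounded.
Qed.

HB.instance Definition _ := Lmodule_isNormed.Build R Linfty
  ler_Linfty_normD Linfty_normZ Linfty_norm_eq0.

End Linfty.
End quotients.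

(* Main.v *)
(* Put mu A = u 1_A, a bounded finitely additive set function that vanishes on
   the null sets of sigma.  Its Yosida-Hewitt decomposition is obtained against
   nu = |sigma| only: for mu >= 0 the meets mu /\ k nu are countably additive
   and increase to the countably additive part c, and p = mu - c satisfies
   p /\ nu = 0, because mu /\ k nu + p /\ nu <= mu /\ (k + 1) nu.  Since p
   vanishes on nu-null sets, p /\ nu = 0 and Borel-Cantelli already give
   p /\ |lam| = 0 for every countably additive lam, so p is pure.  The
   Radon-Nikodym theorem and a Hahn decomposition of sigma turn c into h sigma,
   and both sides of the formula are limits along simple functions that
   converge uniformly to f off a null set.  For uniqueness, the difference of
   two pure parts is countably additive, hence dominated by measures to which
   it is orthogonal, hence zero. *)

Require Import Defs.
From HB Require Import structures.
From mathcomp Require Import all_boot all_order all_algebra.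
From mathcomp Require Import all_classical all_reals all_analysis.
From mathcomp Require Import measurable_realfun zify ring lra.
(* Defs is imported again because all_analysis shadows its [variation]. *)
Import HBSimple Defs.
Set Implicit Arguments.
Unset Strict Implicit.
Unset Printing Implicit Defensive.
Import Order.TTheory GRing.Theory Num.Theory.
Import numFieldNormedType.Exports.
Local Open Scope classical_set_scope.
Local Open Scope ring_scope.

(** * Integration of simple functions against additive set functions *)

(** A representative of a class in [L1] or [Linfty] is a limit in measure of simple functions and
    need not be measurable for [Sigma], so the Lebesgue integral does not apply to it directly. A
    subsequence converging off a null set supplies a measurable substitute, and integrals are
    compared through that substitute. The common ground of the two theories of integration is
    [sint], the real-valued integral of simple functions: a linear functional on simple functions is
    determined by its values on indicators, and this applies to Lebesgue integrals and to [u] alike.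
    Orthogonality of p and nu is carried along as a statement about sets: for every e there is B
    with |p|(B) < e and nu(~B) < e. This is the form that Borel-Cantelli consumes, and it makes no
    reference to the measure against which purity is tested. Boundedness of [sigma] comes from its
    Hahn decomposition, which also provides a density of [sigma] with respect to |sigma| with values
    1 and -1; since its square is 1, passing between integrals against [sigma] and against |sigma|
    is multiplication by this sign. *)

Lemma finite_uniq_seq (I : choiceType) (D : set I) : finite_set D ->
  exists2 r : seq I, uniq r & D = [set` r].
Proof.
move=> /finite_seqP[r ->]; exists (undup r); first exact: undup_uniq.
by apply/seteqP; split => x /=; rewrite mem_undup.
Qed.

Section finitely_additive.
Context {R : realType} {T : Type} (Sigma : set (set T)).
Hypothesis hS : sigma_algebra setT Sigma.
Implicit Types (A B N : set T) (s t : T -> R) (mu nu : set T -> R).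

Lemma salg0 : Sigma set0. Proof. by case: hS. Qed.

Lemma salgC A : Sigma A -> Sigma (~` A).
Proof. by case: hS => _ + _ => /[apply]; rewrite setTD. Qed.

Lemma salg_bigcup (F : (set T)^nat) :
  (forall i, Sigma (F i)) -> Sigma (\bigcup_i F i).
Proof. by case: hS => _ _; apply. Qed.

Lemma salgT : Sigma setT.
Proof. by rewrite -setC0; exact: salgC salg0. Qed.

Lemma salgU A B : Sigma A -> Sigma B -> Sigma (A `|` B).
Proof.
move=> hA hB; rewrite -bigcup2E; apply: salg_bigcup => i.
by rewrite /bigcup2; case: ifP => // _; case: ifP => // _; exact: salg0.
Qed.

Lemma salgI A B : Sigma A -> Sigma B -> Sigma (A `&` B).
Proof.
by move=> hA hB; rewrite -[A]setCK -[B]setCK -setCU; apply/salgC/salgU; apply: salgC.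
Qed.

Lemma salgD A B : Sigma A -> Sigma B -> Sigma (A `\` B).
Proof. by move=> hA hB; rewrite setDE; apply: salgI => //; exact: salgC. Qed.

Lemma salg_fin_bigcup (I : choiceType) (D : set I) (F : I -> set T) :
  finite_set D -> (forall i, Sigma (F i)) -> Sigma (\bigcup_(i in D) F i).
Proof.
move=> /finite_seqP[r ->] hF; rewrite bigcup_seq.
by apply: big_ind => //; [exact: salg0|exact: salgU].
Qed.

Lemma salg_preimage (I : choiceType) (D : set I) (phi : T -> I) :
  finite_set D -> (forall i, Sigma (phi @^-1` [set i])) ->
  Sigma (phi @^-1` D).
Proof.
move=> fD hphi; rewrite (_ : _ @^-1` D = \bigcup_(i in D) phi @^-1` [set i]).
  exact: salg_fin_bigcup.
by apply/seteqP; split => [x Dx|x [i Di /= ->]//]; exists (phi x).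
Qed.

Lemma simple_comp (I : choiceType) (phi : T -> I) (g : I -> R) :
  finite_set (range phi) -> (forall i, Sigma (phi @^-1` [set i])) ->
  simple Sigma (g \o phi).
Proof.
move=> fphi hphi; split; first by rewrite -(image_comp phi g); exact: finite_image.
move=> y; rewrite (_ : _ @^-1` _ = phi @^-1` (range phi `&` g @^-1` [set y])).
  by apply: salg_preimage => //; exact: finite_setIl.
by apply/seteqP; split => x /= => [gy|[_ //]]; split => //; exists x.
Qed.

(** The level sets of the pair are the common refinement of two partitions. Products and differences
    then reduce to [simple_comp], and additivity of [sint] to [sint_comp]. *)
Lemma simple_pair s t : simple Sigma s -> simple Sigma t ->
  finite_set (range (fun x => (s x, t x))) /\
  forall i, Sigma ((fun x => (s x, t x)) @^-1` [set i]).
Proof.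
move=> [fs Ss] [ft St]; split.
  apply: sub_finite_set (finite_setX fs ft) => _ [x _ <-].
  by split => /=; exists x.
move=> [a b]; rewrite (_ : _ @^-1` _ = s @^-1` [set a] `&` t @^-1` [set b]).
  exact: salgI.
by apply/seteqP; split => x /= => [[-> ->]|[-> ->]].
Qed.

Lemma simpleM s t : simple Sigma s -> simple Sigma t ->
  simple Sigma (fun x => s x * t x).
Proof.
move=> hs ht; have [f S] := simple_pair hs ht.
exact: (simple_comp (fun z => z.1 * z.2) f S).
Qed.

Lemma simpleB s t : simple Sigma s -> simple Sigma t ->
  simple Sigma (fun x => s x - t x).
Proof.
move=> hs ht; have [f S] := simple_pair hs ht.
exact: (simple_comp (fun z => z.1 - z.2) f S).
Qed.

Lemma simple_norm s : simple Sigma s -> simple Sigma (fun x => `|s x|).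
Proof. by move=> [fs Ss]; exact: (simple_comp (@Num.norm _ R) fs Ss). Qed.

Lemma simple_indic A : Sigma A -> simple Sigma (\1_A : T -> R).
Proof.
move=> SA; split.
  by apply: (@sub_finite_set _ _ [set 0; 1]) => // _ [x _ <-];
    rewrite indicE; case: (_ \in _); [right|left].
move=> y; have [->|y1] := eqVneq y 1.
  rewrite (_ : _ @^-1` _ = A)//; apply/seteqP; split => x /=; rewrite indicE.
    by case: (boolP (x \in A)) => [/set_mem//|_ /eqP]; rewrite eq_sym oner_eq0.
  by move=> /mem_set ->.
have [->|y0] := eqVneq y 0.
  rewrite (_ : _ @^-1` _ = ~` A); first exact: salgC.
  apply/seteqP; split => x /=; rewrite indicE.
    by case: (boolP (x \in A)) => [_ /eqP|/negP + _ /mem_set//]; rewrite oner_eq0.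
  by move=> /(contra_not set_mem) /negP/negbTE ->.
rewrite (_ : _ @^-1` _ = set0); first exact: salg0.
apply/seteqP; split => x //=; rewrite indicE => /esym/eqP.
by case: (x \in A); rewrite ?(negbTE y0) ?(negbTE y1).
Qed.

Lemma simple_bounded_norm s : simple Sigma s ->
  exists2 b : R, 0 <= b & forall x, `|s x| <= b.
Proof.
move=> [/finite_seqP[r rE] _].
exists (\sum_(y <- r) `|y|); first exact: sumr_ge0.
move=> x; have : (s x) \in r by have : [set` r] (s x) by rewrite -rE; exists x.
elim: r {rE} => // a r IH; rewrite inE big_cons => /predU1P[->|/IH h].
  by rewrite lerDl sumr_ge0.
by rewrite (le_trans h)// lerDr.
Qed.

(** Real-valued counterpart of [sintegral]. A value outside the range would contribute a multiple of
    [mu set0], which is 0 for additive [mu], so the two agree ([sintegral_sint]). *)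
Definition sint mu s : R := \sum_(y \in range s) y * mu (s @^-1` [set y]).

Section one_measure.
Variable mu : set T -> R.
Hypothesis amu : fin_additive Sigma mu.

Lemma fin_additive0 : mu set0 = 0.
Proof.
by have := amu salg0 salg0 (setI0 _); rewrite setU0 -[LHS]addr0 => /addrI.
Qed.

Lemma fin_additiveID A B : Sigma A -> Sigma B ->
  mu A = mu (A `&` B) + mu (A `\` B).
Proof.
move=> SA SB; rewrite -amu ?setUIDK//; [exact: salgI|exact: salgD|].
by rewrite setIDA setIAC setDE -!setIA setICr !setI0.
Qed.

Lemma fin_additiveD A B : Sigma A -> Sigma B -> B `<=` A ->
  mu (A `\` B) = mu A - mu B.
Proof.
move=> SA SB BA; rewrite (fin_additiveID SA SB) setIidr//.
by rewrite addrAC subrr add0r.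
Qed.

Lemma fin_additive_preimage (I : choiceType) (D : set I) (phi : T -> I) :
  finite_set D -> (forall i, Sigma (phi @^-1` [set i])) ->
  mu (phi @^-1` D) = \sum_(i \in D) mu (phi @^-1` [set i]).
Proof.
move=> /finite_uniq_seq[r ur ->] hphi.
rewrite -fsbig_seq//; elim: r ur => [_|a l IH /= /andP[al ul]].
  rewrite big_nil (_ : phi @^-1` _ = set0) ?fin_additive0//.
  by apply/seteqP; split.
rewrite big_cons -IH// -amu//.
- by congr mu; apply/seteqP; split => x /=; rewrite inE;
    [move=> /predU1P[|]; [left|right]|move=> [->|->]; rewrite ?eqxx ?orbT].
- by apply: salg_preimage => //; exact: finite_seq.
- by apply/seteqP; split => x //= [-> al']; rewrite al' in al.
Qed.

(** Each fibre of [g \o phi] is a finite disjoint union of fibres of [phi]; additivity produces a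
    double sum, which is exchanged. Thus [sint] may be evaluated on any finite partition finer than
    the level sets. *)
Lemma sint_comp (I : choiceType) (phi : T -> I) (g : I -> R) :
  finite_set (range phi) -> (forall i, Sigma (phi @^-1` [set i])) ->
  sint mu (g \o phi) = \sum_(i \in range phi) g i * mu (phi @^-1` [set i]).
Proof.
move=> fphi hphi; have fg : finite_set (range (g \o phi)).
  by rewrite -(image_comp phi g); exact: finite_image.
rewrite /sint (eq_fsbigr (fun y => \sum_(i \in range phi)
    if y \in [set g i] then g i * mu (phi @^-1` [set i]) else 0)); last first.
  move=> y _; rewrite (_ : _ @^-1` _ = phi @^-1` (range phi `&` g @^-1` [set y])).
    rewrite fin_additive_preimage//; last exact: finite_setIl.
    rewrite fsbig_mkcondr mulr_fsumr; apply: eq_fsbigr => i _.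
    have [/set_mem/= <-|/negP h] := boolP (i \in _); first by rewrite mem_set.
    by rewrite mulr0 ifF//; apply/negP => /set_mem /= e; apply: h; rewrite inE.
  by apply/seteqP; split => x /= => [gy|[_ //]]; split => //; exists x.
rewrite exchange_fsbig//; apply: eq_fsbigr => i /set_mem[x _ xi].
rewrite -fsbig_mkcondr setIidr ?fsbig_set1// => _ ->.
by exists x => //=; rewrite xi.
Qed.

Lemma sintD s t : simple Sigma s -> simple Sigma t ->
  sint mu (fun x => s x + t x) = sint mu s + sint mu t.
Proof.
move=> hs ht; have [f S] := simple_pair hs ht.
rewrite (sint_comp (fun z => z.1 + z.2) f S).
rewrite (sint_comp fst f S) (sint_comp snd f S) -fsbig_split//.
by apply: eq_fsbigr => i _; rewrite mulrDl.
Qed.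

Lemma sintB s t : simple Sigma s -> simple Sigma t ->
  sint mu (fun x => s x - t x) = sint mu s - sint mu t.
Proof.
move=> hs ht; rewrite -[in RHS](_ : (fun x => s x - t x + t x) = s).
  by rewrite (sintD (simpleB hs ht) ht) addrK.
by apply/funext => x; rewrite subrK.
Qed.

Lemma sintZ c s : simple Sigma s -> sint mu (fun x => c * s x) = c * sint mu s.
Proof.
move=> [f S]; rewrite (sint_comp (fun z => c * z) f S) mulr_fsumr.
by apply: eq_fsbigr => i _; rewrite mulrA.
Qed.

Lemma sint_indic A : Sigma A -> sint mu \1_A = mu A.
Proof.
move=> SA; have [f S] := simple_indic SA.
rewrite /sint (@fsbig_widen _ _ _ _ _ [set 0; 1])//; last first.
- move=> y [_ yr]; rewrite /= (_ : _ @^-1` _ = set0) ?fin_additive0 ?mulr0//.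
  by apply/seteqP; split => // x /= xy; apply: yr; exists x.
- by move=> _ [x _ <-]; rewrite indicE; case: (x \in A); [right|left].
rewrite fsbigU0//; last by move=> x [/= -> /esym/eqP]; rewrite oner_eq0.
rewrite !fsbig_set1 /= mul0r add0r mul1r; congr mu.
apply/seteqP; split => x /=; rewrite indicE.
  by case: (boolP (x \in A)) => [/set_mem//|_ /eqP]; rewrite eq_sym oner_eq0.
by move=> /mem_set ->.
Qed.

Lemma sint_cst c : sint mu (fun=> c) = c * mu setT.
Proof.
rewrite -(sint_indic salgT) -sintZ//; last exact/simple_indic/salgT.
by congr sint; apply/funext => x; rewrite indicE in_setT mulr1.
Qed.

End one_measure.

Lemma simple_decomp s (r : seq R) : uniq r -> range s = [set` r] ->
  s = (fun x => \sum_(y <- r) y * \1_(s @^-1` [set y]) x).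
Proof.
move=> ur rE; apply/funext => x.
have sr : s x \in r by have : [set` r] (s x) by rewrite -rE; exists x.
rewrite (bigD1_seq (s x))//= indicE mem_set// mulr1 big1 ?addr0// => y ys.
by rewrite indicE memNset ?mulr0//= => e; rewrite e eqxx in ys.
Qed.

(** A simple function is a finite combination of indicators of its level sets, so linearity leaves
    only the values on indicators. *)
Lemma sint_unique (Phi : (T -> R) -> R) mu :
  (forall s t, simple Sigma s -> simple Sigma t ->
     Phi (fun x => s x + t x) = Phi s + Phi t) ->
  (forall c s, simple Sigma s -> Phi (fun x => c * s x) = c * Phi s) ->
  (forall A, Sigma A -> Phi \1_A = mu A) ->
  forall s, simple Sigma s -> Phi s = sint mu s.
Proof.
move=> PD PZ P1 s hs; have [f S] := hs.
have [r ur rE] := finite_uniq_seq f.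
rewrite [in LHS](simple_decomp ur rE) /sint rE -fsbig_seq//.
have hZ y : simple Sigma (fun x => y * \1_(s @^-1` [set y]) x).
  by apply: simpleM; [exact: simple_cst|exact: simple_indic].
suff [_ ->] :
    simple Sigma (fun x => \sum_(y <- r) y * \1_(s @^-1` [set y]) x) /\
    Phi (fun x => \sum_(y <- r) y * \1_(s @^-1` [set y]) x) =
    \sum_(y <- r) y * mu (s @^-1` [set y]) by [].
elim: r {ur rE} => [|a r [hr IH]].
  under eq_fun do rewrite big_nil; split; first exact: simple_cst.
  rewrite big_nil -[RHS](mul0r (Phi (fun=> 0))) -PZ; last exact: simple_cst.
  by congr Phi; apply/funext => x; rewrite mul0r.
under eq_fun do rewrite big_cons; split; first exact: simpleD.
by rewrite PD// PZ ?P1 ?IH ?big_cons//; exact: simple_indic.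
Qed.

Section nonnegative.
Variable nu : set T -> R.
Hypotheses (anu : fin_additive Sigma nu) (nu0 : forall A, Sigma A -> 0 <= nu A).

Lemma fin_additive_le A B : Sigma A -> Sigma B -> A `<=` B -> nu A <= nu B.
Proof.
move=> SA SB AB; rewrite -subr_ge0 -fin_additiveD//; apply: nu0; exact: salgD.
Qed.

Lemma fin_additive_leU A B : Sigma A -> Sigma B -> nu (A `|` B) <= nu A + nu B.
Proof.
move=> SA SB; rewrite (fin_additiveID anu (salgU SA SB) SA) setUK lerD2l.
by apply: fin_additive_le => //; [apply: salgD => //; exact: salgU|];
  move=> x [[]].
Qed.

(** A negative value is taken only inside [N], so its level set has measure 0. Comparisons of [sint]
    thereby tolerate an exceptional null set. *)
Lemma sint_ge0_null s N : simple Sigma s -> Sigma N -> nu N = 0 ->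
  (forall x, ~ N x -> 0 <= s x) -> 0 <= sint nu s.
Proof.
move=> [f S] SN N0 sN; apply: fsumr_ge0 => y _.
have [y0|y0] := leP 0 y; first by rewrite mulr_ge0// nu0.
suff -> : nu (s @^-1` [set y]) = 0 by rewrite mulr0.
apply/le_anti; rewrite nu0// andbT -N0; apply: fin_additive_le => // x /= xy.
by apply: contrapT => /sN; rewrite xy leNgt y0.
Qed.

Lemma le_sint_null s t N : simple Sigma s -> simple Sigma t ->
  Sigma N -> nu N = 0 -> (forall x, ~ N x -> s x <= t x) ->
  sint nu s <= sint nu t.
Proof.
move=> hs ht SN N0 st; rewrite -subr_ge0 -sintB//.
by apply: (@sint_ge0_null _ N) => //; [exact: simpleB|move=> x /st; rewrite subr_ge0].
Qed.

Lemma le_sint s t : simple Sigma s -> simple Sigma t ->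
  (forall x, s x <= t x) -> sint nu s <= sint nu t.
Proof.
move=> hs ht st; apply: (@le_sint_null _ _ set0) => //; first exact: salg0.
exact: fin_additive0.
Qed.

End nonnegative.

(** [fine] would send an infinite variation to 0; by [rvarE] this does not happen for [mu] in
    [ba]. *)
Definition rvar mu A : R := fine (variation Sigma mu A).

(** In a disjoint family, the pieces with [mu >= 0] and those with [mu < 0] have unions [B] and [B']
    inside [A], and the sum of the absolute values is [mu B - mu B']; hence [M + M]. *)
Lemma variation_le mu A M : fin_additive Sigma mu ->
  (forall B, Sigma B -> B `<=` A -> `|mu B| <= M) ->
  (variation Sigma mu A <= (M + M)%:E)%E.
Proof.
move=> amu hM; apply: ge_ereal_sup => _ [k [F [hF tF ->]]].
have bigU (P : pred 'I_k) : let B := \big[setU/set0]_(i < k | P i) F i in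
    [/\ Sigma B, B `<=` A & mu B = \sum_(i < k | P i) mu (F i)].
  rewrite /= -big_filter -[X in _ = X]big_filter.
  have : uniq [seq i <- index_enum 'I_k | P i].
    by rewrite filter_uniq ?index_enum_uniq.
  elim: [seq _ <- _ | _] => [_|i r IH /= /andP[ir ur]].
    by rewrite !big_nil; split => //; [exact: salg0|exact: fin_additive0].
  have [SB BA muB] := IH ur; have [SF FA] := hF i.
  rewrite !big_cons; split; first exact: salgU.
    by move=> x [/FA|/BA].
  rewrite amu ?muB//; apply/seteqP; split => // x [Fix].
  rewrite -bigcup_seq => -[j /= jr Fjx].
  have ij : i = j by apply: tF => //; exists x.
  by rewrite ij jr in ir.
rewrite lee_fin (bigID (fun i => 0 <= mu (F i)))/=.
have [SB BA muB] := bigU (fun i => 0 <= mu (F i)).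
have [SB' BA' muB'] := bigU (fun i => ~~ (0 <= mu (F i))).
apply: lerD.
  rewrite (eq_bigr (fun i => mu (F i))); last by move=> i /ger0_norm.
  by rewrite -muB (le_trans (ler_norm _))// hM.
rewrite (eq_bigr (fun i => - mu (F i))); last first.
  by move=> i; rewrite -ltNge => /ltr0_norm.
by rewrite sumrN -muB' (le_trans (ler_norm _))// normrN hM.
Qed.

Section bounded.
Variable mu : set T -> R.
Hypothesis hmu : ba Sigma mu.

Lemma ba_variation_fin A : variation Sigma mu A \is a fin_num.
Proof.
have [amu [M hM]] := hmu; rewrite ge0_fin_numE ?variation_ge0//.
by apply: le_lt_trans (variation_le amu _) (ltry (M + M)) => B SB _; exact: hM.
Qed.

Lemma rvarE A : (rvar mu A)%:E = variation Sigma mu A.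
Proof. by rewrite fineK// ba_variation_fin. Qed.

Lemma rvar_ge0 A : 0 <= rvar mu A.
Proof. by rewrite fine_ge0// variation_ge0. Qed.

Lemma le_rvar A B : A `<=` B -> rvar mu A <= rvar mu B.
Proof. by move=> AB; rewrite -lee_fin !rvarE le_variation. Qed.

Lemma le_abs_rvar A : Sigma A -> `|mu A| <= rvar mu A.
Proof. by move=> SA; rewrite -lee_fin rvarE le_abs_variation. Qed.

(** A disjoint family in [A] and one in [B] are concatenated, with indices in ['I_(k + l)];
    disjointness of [A] and [B] keeps the joint family disjoint. *)
Lemma rvarU_disj A B : A `&` B = set0 ->
  rvar mu A + rvar mu B <= rvar mu (A `|` B).
Proof.
move=> AB; rewrite -lee_fin EFinD !rvarE.
have [vA vB] := (ba_variation_fin A, ba_variation_fin B).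
rewrite -leeBrDr//; apply: ge_ereal_sup => _ [k [F [hF tF ->]]].
rewrite leeBrDr// addeC -leeBrDr//.
apply: ge_ereal_sup => _ [l [G [hG tG ->]]].
rewrite leeBrDr// addeC -EFinD; apply: ereal_sup_ubound.
exists (k + l)%N, (fun i => match fintype.split i with inl j => F j | inr j => G j end).
split.
- move=> i; case: (fintype.split i) => j.
    by have [? h] := hF j; split => // x /h; left.
  by have [? h] := hG j; split => // x /h; right.
- move=> i j _ _.
  case: fintype.splitP => i' ei; case: fintype.splitP => j' ej [x [/= h1 h2]].
  + by apply/ord_inj; rewrite ei ej (tF i' j')//; exists x.
  + have : (A `&` B) x by split; [exact: (hF _).2 h1|exact: (hG _).2 h2].
    by rewrite AB.
  + have : (A `&` B) x by split; [exact: (hF _).2 h2|exact: (hG _).2 h1].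
    by rewrite AB.
  + by apply/ord_inj; rewrite ei ej (tG i' j')//; exists x.
- rewrite big_split_ord/=; congr (_ + _)%:E; apply: eq_bigr => i _.
    case: fintype.splitP => j /= e; first by rewrite (ord_inj e).
    by have := ltn_ord i; rewrite e ltnNge leq_addr.
  case: fintype.splitP => j /= e.
    by have := ltn_ord j; rewrite -e ltnNge leq_addr.
  by rewrite (@ord_inj _ i j)//; apply/eqP; rewrite -(eqn_add2l k) e.
Qed.

Lemma rvar_fin_additive : fin_additive Sigma (rvar mu).
Proof.
move=> A B SA SB AB; apply/le_anti; rewrite rvarU_disj// andbT.
by rewrite -lee_fin EFinD !rvarE; exact: variationU hmu.1 SA.
Qed.

(** The variation is the least additive majorant: the sum over a disjoint family is at most [nu] of
    its union, and [nu] is nonnegative on the rest of [A]. *)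
Lemma le_rvar_fin_additive nu A : Sigma A -> fin_additive Sigma nu ->
  (forall B, Sigma B -> B `<=` A -> `|mu B| <= nu B) -> rvar mu A <= nu A.
Proof.
move=> SA anu h; rewrite -lee_fin rvarE.
apply: ge_ereal_sup => _ [k [F [hF tF ->]]]; rewrite lee_fin.
have nu0 B : Sigma B -> B `<=` A -> 0 <= nu B.
  by move=> SB BA; exact: le_trans (normr_ge0 _) (h _ SB BA).
have [r rE] : exists r, r = index_enum 'I_k by exists (index_enum 'I_k).
have : uniq r by rewrite rE index_enum_uniq.
rewrite -rE => {rE} ur.
suff [SB BA hB] : let B := \big[setU/set0]_(i <- r) F i in
    [/\ Sigma B, B `<=` A & \sum_(i <- r) `|mu (F i)| <= nu B].
  apply: le_trans hB _; rewrite -subr_ge0 -fin_additiveD//.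
  by apply: nu0; [exact: salgD|move=> x []].
elim: r ur => [_|i r IH /= /andP[ir ur]].
  by rewrite !big_nil; split => //; [exact: salg0|rewrite fin_additive0].
have [SB BA muB] := IH ur; have [SF FA] := hF i.
rewrite !big_cons; split; [exact: salgU|by move=> x [/FA|/BA]|].
rewrite anu//; first by rewrite lerD// h.
apply/seteqP; split => // x [Fix]; rewrite -bigcup_seq => -[j /= jr Fjx].
have ij : i = j by apply: tF => //; exists x.
by rewrite ij jr in ir.
Qed.

Lemma le_abs_sint s : simple Sigma s ->
  `|sint mu s| <= sint (rvar mu) (fun x => `|s x|).
Proof.
move=> [f S]; rewrite (sint_comp rvar_fin_additive (@Num.norm _ R) f S).
rewrite /sint !fsbig_finite//; apply: le_trans (ler_norm_sum _ _ _) _.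
by apply: ler_sum => y _; rewrite normrM ler_wpM2l// le_abs_rvar.
Qed.

End bounded.
End finitely_additive.

(** * The integral against a bounded additive set function *)

Section integral.
Context {R : realType} {T : Type} (Sigma : set (set T)).
Hypothesis hS : sigma_algebra setT Sigma.
Implicit Types (A B N : set T) (f s t : T -> R).

Lemma sintegral_sint (mu : set T -> R) s : fin_additive Sigma mu ->
  simple Sigma s -> sintegral (EFin \o mu) s = (sint mu s)%:E.
Proof.
move=> amu [f _]; rewrite /sintegral /sint.
rewrite -(@fsbig_widen _ _ _ _ (range s) setT)//; last first.
  move=> y [_ yr]; rewrite /= (_ : _ @^-1` _ = set0).
    by rewrite (fin_additive0 hS)// mule0.
  by apply/seteqP; split => // x /= xy; apply: yr; exists x.
by rewrite fsbig_finite//= fsbig_finite//= -sumEFin.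
Qed.

Variable mu : set T -> R.
Hypothesis hmu : ba Sigma mu.
Local Notation nu := (rvar Sigma mu).

Let anu : fin_additive Sigma nu. Proof. exact: rvar_fin_additive. Qed.

Let nu0 A : Sigma A -> 0 <= nu A. Proof. by move=> _; exact: rvar_ge0. Qed.

Lemma sintegral_variation s : simple Sigma s ->
  sintegral (variation Sigma mu) s = (sint nu s)%:E.
Proof.
move=> hs; rewrite -sintegral_sint//; congr sintegral.
by apply/funext => A; rewrite /= rvarE.
Qed.

Lemma cvg_in_measureP (F : (T -> R)^nat) f :
  cvg_in_measure Sigma mu F f <-> forall e d : R, 0 < e -> 0 < d ->
  \forall k \near \oo, exists A,
    [/\ Sigma A, [set x | e < `|F k x - f x|] `<=` A & nu A < d].
Proof.
have E k e d :
    (outer_variation Sigma mu [set x | (e < `|F k x - f x|)%R] < d%:E)%E <->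
    exists A, [/\ Sigma A, [set x | e < `|F k x - f x|] `<=` A & nu A < d].
  split=> [/outer_variation_lt|] [A [SA fA Ad]].
    by exists A; split => //; rewrite -lte_fin rvarE.
  by apply/outer_variation_lt; exists A; split => //; rewrite -rvarE// lte_fin.
have ge0 e k := @outer_variation_ge0 R T Sigma mu [set x | e < `|F k x - f x|].
split=> [h e d e0 d0|h e e0].
  have /ge0_cvge0P/(_ d d0) := h e e0.
  by move/(_ (ge0 e)); apply: filterS => k /E.
by apply/ge0_cvge0P => // d d0; apply: filterS (h e d e0 d0) => k /E.
Qed.

(** Finite variation makes every simple function integrable and turns [sintegral] into the real
    number [sint nu], so the double limit becomes an ordinary Cauchy condition. *)
Lemma determining_seqP (F : (T -> R)^nat) f : determining_seq Sigma mu F f <->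
  [/\ forall k, simple Sigma (F k), cvg_in_measure Sigma mu F f &
      forall e : R, 0 < e -> exists K, forall k l, (K <= k)%N -> (K <= l)%N ->
        sint nu (fun x => `|F k x - F l x|) < e].
Proof.
have sE (sF : forall k, simple Sigma (F k)) k l :
    sintegral (variation Sigma mu) (fun x => `|F k x - F l x|) =
    (sint nu (fun x => `|F k x - F l x|))%:E.
  by rewrite sintegral_variation//; exact/simple_norm/simpleB.
have s0 (sF : forall k, simple Sigma (F k)) k l :
    0 <= sint nu (fun x => `|F k x - F l x|).
  apply: (@sint_ge0_null _ _ _ hS _ _ nu0 _ set0) => //.
  - exact/simple_norm/simpleB.
  - exact: salg0.
  - exact: (fin_additive0 hS).
split=> [[sF Ff Fc]|[sF Ff Fc]]; split => //.
- by move=> k; have [] := sF k.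
- have {}sF k : simple Sigma (F k) by have [] := sF k.
  move=> e e0; move: Fc; rewrite (_ : (fun kl => _) =
    EFin \o (fun kl => sint nu (fun x => `|F kl.1 x - F kl.2 x|))); last first.
    by apply/funext => -[k l] /=; rewrite sE.
  move=> /fine_cvgP[_] /cvgr0Pnorm_lt/(_ e e0)[[P Q] [/= [K _ KP] [L _ LQ]] PQ].
  exists (maxn K L) => k l; rewrite !geq_max => /andP[Kk Lk] /andP[Kl Ll].
  have := PQ (k, l); rewrite /= ger0_norm ?s0//; apply.
  by split => /=; [exact: KP|exact: LQ].
- move=> k; split => // y y0; rewrite ltey_eq.
  by rewrite ba_variation_fin.
- rewrite (_ : (fun kl => _) =
    EFin \o (fun kl => sint nu (fun x => `|F kl.1 x - F kl.2 x|))); last first.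
    by apply/funext => -[k l] /=; rewrite sE.
  apply/fine_cvgP; split; first by apply: nearW => kl.
  apply/cvgr0Pnorm_lt => e e0; have [K hK] := Fc e e0.
  exists ([set k | (K <= k)%N], [set k | (K <= k)%N]).
    by split; exists K.
  by move=> [k l] [/= Kk Kl]; rewrite ger0_norm ?s0// hK.
Qed.

Lemma le_sint_dist (F : (T -> R)^nat) k l : (forall k, simple Sigma (F k)) ->
  `|sint mu (F k) - sint mu (F l)| <= sint nu (fun x => `|F k x - F l x|).
Proof.
move=> sF; rewrite -(sintB hS hmu.1)//; apply: le_abs_sint => //.
exact: simpleB.
Qed.

Lemma determining_cvg (F : (T -> R)^nat) f : determining_seq Sigma mu F f ->
  cvg (sint mu (F k) @[k --> \oo]).
Proof.
move=> /determining_seqP[sF _ Fc]; apply: cauchy_cvg; apply: cauchy_exP => e e0.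
have [K hK] := Fc e e0; exists (sint mu (F K)); exists K => // k /= Kk.
exact: le_lt_trans (le_sint_dist K k sF) (hK K k (leqnn K) Kk).
Qed.

(** [F k - G k] is compared with the fixed difference [F M - G M], whose bound [b] is known before
    [k] is chosen. On the small set where [F k] or [G k] is far from [f], the bound [b] and the
    Cauchy conditions are used; elsewhere the difference is at most [d]. *)
Lemma determining_unique (F G : (T -> R)^nat) f (v w : R) :
  determining_seq Sigma mu F f -> determining_seq Sigma mu G f ->
  sint mu (F k) @[k --> \oo] --> v -> sint mu (G k) @[k --> \oo] --> w -> v = w.
Proof.
move=> /determining_seqP[sF Ff Fc] /determining_seqP[sG Gf Gc] Fv Gw.
have sFG k : simple Sigma (fun x => F k x - G k x) by exact: simpleB.
have sN k : simple Sigma (fun x => `|F k x - G k x|) by exact: simple_norm.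
suff : sint mu (F k) - sint mu (G k) @[k --> \oo] --> (0 : R).
  move=> h; apply/eqP; rewrite -subr_eq0; apply/eqP.
  rewrite -(cvg_lim (@Rhausdorff R) (cvgB Fv Gw)).
  exact: (cvg_lim (@Rhausdorff R) h).
(* Each Cauchy condition costs one [r], the two exceptional sets cost two and the constant [d] costs
   one; the sixth is slack. *)
apply/cvgr0Pnorm_lt => e e0; pose r := e / 6; have r0 : 0 < r by rewrite divr_gt0.
have [K hK] := Fc _ r0; have [L hL] := Gc _ r0; pose M := maxn K L.
have [b b0 hb] := simple_bounded_norm (sFG M).
have b1 : 0 < b + 1 by rewrite ltr_wpDl.
have c1 : 0 < nu setT + 1 by rewrite ltr_wpDl// rvar_ge0.
pose d := r / (nu setT + 1).
have d20 : 0 < d / 2 by rewrite !divr_gt0.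
have /cvg_in_measureP/(_ _ _ d20 (divr_gt0 r0 b1)) hF := Ff.
have /cvg_in_measureP/(_ _ _ d20 (divr_gt0 r0 b1)) hG := Gf.
near=> k.
have [A [SA FA nA]] : exists A, [/\ Sigma A,
    [set x | d / 2 < `|F k x - f x|] `<=` A & nu A < r / (b + 1)] by near: k.
have [B [SB GB nB]] : exists A, [/\ Sigma A,
    [set x | d / 2 < `|G k x - f x|] `<=` A & nu A < r / (b + 1)] by near: k.
have SAB : Sigma (A `|` B) by exact: salgU.
have kM : (M <= k)%N by near: k; exact: nbhs_infty_ge.
have [kK kL] : (K <= k)%N /\ (L <= k)%N by move: kM; rewrite geq_max => /andP.
rewrite -(sintB hS hmu.1)//; apply: le_lt_trans (le_abs_sint hS hmu (sFG k)) _.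
have sI : simple Sigma (fun x => b * \1_(A `|` B) x).
  by apply: simpleZ => //; exact: simple_indic.
have sFk : simple Sigma (fun x => `|F k x - F M x|).
  exact/simple_norm/simpleB.
have sGk : simple Sigma (fun x => `|G k x - G M x|).
  exact/simple_norm/simpleB.
have sD : simple Sigma (fun=> d) by exact: simple_cst.
apply: (@le_lt_trans _ _ (sint nu (fun x => `|F k x - F M x| +
    (`|G k x - G M x| + (b * \1_(A `|` B) x + d))))).
  apply: (le_sint hS) => //.
    by do 3?apply: (@simpleD _ _ _ hS) => //.
  move=> x; rewrite indicE; have [ABx|nAB] := boolP (x \in A `|` B).
    have -> : F k x - G k x = F k x - F M x - (G k x - G M x) + (F M x - G M x).
      ring.
    rewrite mulr1 [leRHS]addrA; apply: le_trans (ler_normD _ _) _; apply: lerD.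
      exact: ler_normB.
    by rewrite (le_trans (hb x))// lerDl ltW// -(@pmulr_lgt0 _ 2^-1).
  rewrite mulr0 add0r addrA; apply: ler_wpDl; first by rewrite addr_ge0.
  have /not_orP[nA' nB'] : ~ (A `|` B) x by move=> /mem_set; apply/negP.
  have Fd : `|F k x - f x| <= d / 2.
    by rewrite leNgt; apply/negP => h; apply: nA'; exact: FA.
  have Gd : `|G k x - f x| <= d / 2.
    by rewrite leNgt; apply/negP => h; apply: nB'; exact: GB.
  by rewrite (le_trans (ler_distD (f x) _ _))// [leRHS]splitr lerD// distrC.
do 3![rewrite (sintD hS anu)//; try by do 2?apply: (@simpleD _ _ _ hS)].
rewrite (sintZ hS anu) ?(sint_indic hS anu) ?(sint_cst hS anu)//;
  last exact: simple_indic.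
have h1 := hK k M kK (leq_maxl _ _); have h2 := hL k M kL (leq_maxr _ _).
have h3 : b * nu (A `|` B) <= r + r.
  apply: (@le_trans _ _ ((b + 1) * (r / (b + 1) + r / (b + 1)))).
    apply: ler_pM => //; [exact: nu0|by rewrite lerDl|].
    by rewrite (le_trans (fin_additive_leU hS anu nu0 SA SB))// lerD// ltW.
  by rewrite mulrDr mulrC divfK ?gt_eqF.
have h4 : d * nu setT <= r.
  rewrite /d mulrAC ler_pdivrMr// ler_pM2l// lerDl; exact: ler01.
have -> : e = r + (r + (r + r + (r + r))) by rewrite /r; field.
rewrite ltrD// ltrD//.
apply: le_lt_trans (lerD h3 h4) _; rewrite addrA; lra.
Unshelve. all: by end_near. Qed.

(** Independence of the determining sequence leaves a single candidate for [xget], so any one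
    sequence computes the integral. *)
Lemma mu_integralE (F : (T -> R)^nat) f (v : R) : determining_seq Sigma mu F f ->
  sint mu (F k) @[k --> \oo] --> v -> mu_integral Sigma mu f = v.
Proof.
have E (G : (T -> R)^nat) (w : R) : determining_seq Sigma mu G f ->
    sintegral (EFin \o mu) (G k) @[k --> \oo] --> w%:E <->
    sint mu (G k) @[k --> \oo] --> w.
  move=> /determining_seqP[sG _ _].
  rewrite (_ : (fun k => sintegral _ (G k)) = EFin \o (fun k => sint mu (G k))).
    by split=> [/fine_cvgP[]//|h]; apply/fine_cvgP; split=> //; exact: nearW.
  by apply/funext => k /=; rewrite sintegral_sint//; exact: hmu.1.
move=> dF Fv; apply: xget_unique; first by exists F => //; apply/E.
move=> w [G dG /(E _ _ dG) Gw]; exact: determining_unique dG dF Gw Fv.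
Qed.

Lemma mu_integral_cvg (F : (T -> R)^nat) f : determining_seq Sigma mu F f ->
  sint mu (F k) @[k --> \oo] --> mu_integral Sigma mu f.
Proof.
by move=> dF; have h := determining_cvg dF; rewrite (mu_integralE dF h).
Qed.

(** Since [nu setT] is finite, uniform closeness off a null set controls both the convergence in
    measure and the integrals of [|F k - F l|]. *)
Lemma determining_uniform (F : (T -> R)^nat) f N : Sigma N -> nu N = 0 ->
  (forall k, simple Sigma (F k)) ->
  (forall k x, ~ N x -> `|F k x - f x| <= k.+1%:R^-1) ->
  determining_seq Sigma mu F f.
Proof.
move=> SN N0 sF hF; apply/determining_seqP; split => //.
  apply/cvg_in_measureP => e d e0 d0; near=> k.
  exists N; split => //; last by rewrite N0.
  move=> x /= h; apply: contrapT => /(hF k); apply/negP; rewrite -ltNge.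
  apply: lt_trans h; near: k; exact: (near_infty_natSinv_lt (PosNum e0)).
move=> e e0; have c1 : 0 < nu setT + 1 by rewrite ltr_wpDl// rvar_ge0.
(* Two errors of at most this size integrate to at most [e * nu setT / (nu setT + 1)], which is
   below [e]; the added 1 covers [nu setT = 0]. *)
have d0 : 0 < e / (nu setT + 1) / 2 by rewrite !divr_gt0.
have [K _ hK] := near_infty_natSinv_lt (PosNum d0).
exists K => k l Kk Kl.
apply: (@le_lt_trans _ _ (sint nu (fun=> e / (nu setT + 1)))).
  apply: (le_sint_null hS anu nu0 _ _ SN N0).
  - exact/simple_norm/simpleB.
  - exact: simple_cst.
  - move=> x Nx; rewrite (le_trans (ler_distD (f x) _ _))// [leRHS]splitr.
    rewrite lerD//; first by rewrite (le_trans (hF k x Nx))// ltW//; exact: hK.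
    by rewrite distrC (le_trans (hF l x Nx))// ltW//; exact: hK.
by rewrite (sint_cst hS anu) mulrAC ltr_pdivrMr// ltr_pM2l// ltrDl.
Unshelve. all: by end_near. Qed.

End integral.

(** * Comparison with the Lebesgue integral *)

(* A measurableType must be pointed, so the point is part of the alias; the
   empty carrier is treated separately. *)
Definition salgType (T : Type) (Sigma : set (set T))
  (hS : sigma_algebra setT Sigma) (x0 : T) : Type := T.

Section salg_measurable.
Context {T : Type} (Sigma : set (set T)) (hS : sigma_algebra setT Sigma) (x0 : T).
Local Notation mT := (salgType hS x0).

HB.instance Definition _ := gen_eqMixin mT.
HB.instance Definition _ := gen_choiceMixin mT.
HB.instance Definition _ := isPointed.Build mT x0.
HB.instance Definition _ := @isMeasurable.Build (sigma_display Sigma) mT Sigma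
  (salg0 hS) (@salgC _ _ hS) (@salg_bigcup _ _ hS).

End salg_measurable.

(** * Hahn decomposition and total variation of a sigma-measure *)

Section sigma_charge.
Context {R : realType} {T : Type} (Sigma : set (set T)).
Variables (hS : sigma_algebra setT Sigma) (x0 : T).
Local Notation mT := (salgType hS x0).
Variable lam : set T -> R.

(** The hypothesis is an argument so that the charge structure can be attached to
    [sigma_charge hlam]. *)
Definition sigma_charge of sigma_measure Sigma lam := fun A : set mT => (lam A)%:E.

Hypothesis hlam : sigma_measure Sigma lam.

Let sigma_charge0 : sigma_charge hlam set0 = 0%E.
Proof. by rewrite /sigma_charge (fin_additive0 hS hlam.1). Qed.

Let sigma_charge_fin A : measurable A -> sigma_charge hlam A \is a fin_num.
Proof. by []. Qed.

Let sigma_charge_sigma_additive : semi_sigma_additive (sigma_charge hlam).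
Proof.
move=> F mF tF mUF; rewrite (_ : (fun n => _) = EFin \o series (lam \o F)).
  by apply/fine_cvgP; split; [exact: nearW|exact: hlam.2].
by apply/funext => n /=; rewrite /series/= sumEFin.
Qed.

HB.instance Definition _ := isCharge.Build _ _ _ (sigma_charge hlam)
  sigma_charge0 sigma_charge_fin sigma_charge_sigma_additive.

(** [P] is the positive set of a Hahn decomposition and [m] its charge variation [cv], whose
    finiteness bounds [lam]. On the one hand [cv] is an additive majorant of [|lam|], so it
    dominates [rvar]; on the other hand [cv A] is [lam] on the part of [A] in [P] minus [lam] on the
    part in [N], so it is at most [rvar] of [A]. *)
Lemma sigma_measure_variation :
  exists (m : {finite_measure set mT -> \bar R}) (P : set T),
  [/\ ba Sigma lam, Sigma P,
      forall A, Sigma A -> m A = (rvar Sigma lam A)%:E &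
      forall A, Sigma A -> (lam A)%:E = (m (A `&` P) - m (A `\` P))%E].
Proof.
have [P [N PN]] := Hahn_decomposition (sigma_charge hlam).
pose cv := charge_variation PN.
have fcv : fin_num_fun cv by move=> A mA; exact: fin_num_measure.
pose m : {finite_measure set mT -> \bar R} :=
  HB.pack cv (Measure_isFinite.Build _ _ _ cv fcv).
have [[mP posP] [mN negN] PNT PN0] := PN.
have NE : N = ~` P.
  apply/seteqP; split => [x Nx Px|x].
    by have : (P `&` N) x by []; rewrite PN0.
  by have [] : (P `|` N) x by rewrite PNT.
have cvE A : Sigma A -> cv A = ((lam (A `&` P))%:E - (lam (A `&` N))%:E)%E.
  move=> SA; rewrite /cv /charge_variation jordan_posE jordan_negE.
  by rewrite cjordan_posE cjordan_negE /crestr0 mem_set.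
have cvfa : fin_additive Sigma (fine \o cv).
  move=> A B SA SB AB /=; rewrite -fineD ?fcv//; congr fine.
  by have := measureU m SA SB AB.
have abscv A : Sigma A -> `|lam A| <= fine (cv A).
  move=> SA; rewrite -lee_fin fineK ?fcv//; exact: (abse_charge_variation PN).
have bal : ba Sigma lam.
  split; first exact: hlam.1.
  exists (fine (cv setT)) => A SA; rewrite (le_trans (abscv A SA))//.
  rewrite fine_le ?fcv//; apply: (le_measure m); rewrite ?inE//.
have mE A : Sigma A -> m A = (rvar Sigma lam A)%:E.
  move=> SA; rewrite -[m A]fineK ?fcv//; congr EFin; apply/le_anti/andP; split.
    have SAP := salgI hS SA mP; have SAN := salgI hS SA mN.
    have AE : A = (A `&` P) `|` (A `&` N) by rewrite -setIUr PNT setIT.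
    rewrite {2}AE (rvar_fin_additive hS bal)//; last first.
      by rewrite setIACA PN0 setI0.
    rewrite [m A]cvE// fineB//= -[leLHS]/(_ + - _).
    rewrite lerD// (le_trans (ler_norm _))// ?normrN le_abs_rvar//.
  apply: (le_rvar_fin_additive hS bal SA cvfa) => B SB _; exact: abscv.
exists m, P; split => // A SA.
rewrite -[m (A `&` P)]/(cv _) -[m (A `\` P)]/(cv _).
rewrite !cvE; [|exact: salgD|exact: salgI].
have -> : A `&` P `&` P = A `&` P by rewrite -setIA setIid.
have -> : A `&` P `&` N = set0 by rewrite -setIA PN0 setI0.
have -> : (A `\` P) `&` P = set0 by rewrite setDE -setIA setICl setI0.
have -> : (A `\` P) `&` N = A `\` P by rewrite NE setDE -setIA setIid.
rewrite (fin_additive0 hS hlam.1) sube0 sub0e oppeK -EFinD.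
by rewrite -(fin_additiveID hS hlam.1).
Qed.

End sigma_charge.

(** * The integral against sigma as a Lebesgue integral against its variation *)

Section lebesgue.
Context {R : realType} {T : Type} (Sigma : set (set T)).
Variables (hS : sigma_algebra setT Sigma) (x0 : T).
Local Notation mT := (salgType hS x0).
Implicit Types (A B N : set T) (f g s w : T -> R).

Lemma simple_measurable s : simple Sigma s -> measurable_fun setT (s : mT -> R).
Proof.
move=> [f S] _ Y mY; rewrite setTI.
rewrite (_ : s @^-1` Y = s @^-1` (range s `&` Y)); last first.
  by apply/seteqP; split => x /= => [sY|[]//]; split => //; exists x.
by apply: (salg_preimage hS) => //; exact: finite_setIl.
Qed.

Lemma sfun_simple (s : {sfun mT >-> R}) : simple Sigma (s : mT -> R).
Proof. split; [exact: (fimfunP s)|move=> y].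
exact: (measurable_sfunP s (measurable_set1 y)). Qed.

Variable m : {finite_measure set mT -> \bar R}.
Local Notation integrable f := (m.-integrable setT (EFin \o (f : mT -> R))).
Local Notation Int f := (\int[m]_(x in setT) (f : mT -> R) x).

Lemma integrable_bounded_mul f w (b : R) : measurable_fun setT (f : mT -> R) ->
  (forall x, `|f x| <= b) -> integrable w -> integrable (fun x => f x * w x).
Proof.
move=> mf fb iw; have mw := measurable_int _ iw.
apply: (@le_integrable _ mT R m setT measurableT _ (fun x : mT => (b * w x)%:E)) => //.
- apply/measurable_EFinP; apply: measurable_funM => //.
  exact/measurable_EFinP.
- move=> x _ /=; rewrite lee_fin !normrM ler_wpM2r//.
  by rewrite (le_trans (fb x))// ler_norm.
- under eq_fun do rewrite EFinM; exact: integrableZl.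
Qed.

Lemma integrable_simple_mul s w : simple Sigma s -> integrable w ->
  integrable (fun x => s x * w x).
Proof.
move=> hs; have [b _ sb] := simple_bounded_norm hs.
by apply: integrable_bounded_mul sb; exact: simple_measurable.
Qed.

Lemma integrable1 : integrable (fun=> 1 : R).
Proof. exact: finite_measure_integrable_cst. Qed.

Lemma integrable_simple s : simple Sigma s -> integrable s.
Proof.
move=> hs; have := integrable_simple_mul hs integrable1.
by under eq_fun do rewrite mulr1.
Qed.

Lemma Rintegral_simple_mul (lam : set T -> R) w : integrable w ->
  (forall A, Sigma A -> Int (fun x => \1_A x * w x) = lam A) ->
  forall s, simple Sigma s -> Int (fun x => s x * w x) = sint lam s.
Proof.
move=> iw h s hs.
apply: (sint_unique hS (Phi := fun s => Int (fun x => s x * w x))) => //.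
  move=> {hs}s t hs ht; rewrite -RintegralD//; last 2 first.
  - exact: integrable_simple_mul.
  - exact: integrable_simple_mul.
  by apply: eq_Rintegral => x _; rewrite mulrDl.
move=> c {hs}s hs; rewrite -RintegralZl//; last exact: integrable_simple_mul.
by apply: eq_Rintegral => x _; rewrite mulrA.
Qed.

Lemma Rintegral_indic_mul A w : Sigma A ->
  Int (fun x => \1_A x * w x) = \int[m]_(x in A) (w : mT -> R) x.
Proof.
move=> SA; rewrite [RHS]Rintegral_mkcond; apply: eq_Rintegral => x _.
by rewrite patchE indicE; case: ifP => _; rewrite ?mul1r ?mul0r.
Qed.

Lemma eq_Int g f : (forall x, f x = g x) -> Int f = Int g.
Proof. by move=> /funext ->. Qed.

Lemma le_Int f g : integrable f -> integrable g -> (forall x, f x <= g x) ->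
  Int f <= Int g.
Proof. by move=> hf hg fg; apply: le_Rintegral => // x _; exact: fg. Qed.

Lemma integrable_add f g : integrable f -> integrable g ->
  integrable (fun x => f x + g x).
Proof. by move=> hf hg; exact: (integrableD measurableT hf hg). Qed.

Lemma integrable_sub f g : integrable f -> integrable g ->
  integrable (fun x => f x - g x).
Proof. by move=> hf hg; exact: (integrableB measurableT hf hg). Qed.

Lemma integrable_dist f g : integrable f -> integrable g ->
  integrable (fun x => `|f x - g x|).
Proof.
by move=> hf hg; exact: (integrable_abse (integrable_sub hf hg)).
Qed.

Lemma Rintegral_approx g : integrable g -> exists s : (T -> R)^nat,
  (forall k, simple Sigma (s k)) /\
  Int (fun x => `|g x - s k x|) @[k --> \oo] --> (0 : R).
Proof.
move=> ig; have [s [_ _ sg]] := approximation_sfun_integrable measurableT ig.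
exists (fun k => (s k : mT -> R)); split; first by move=> k; exact: sfun_simple.
by move: sg => /fine_cvgP[_].
Qed.

Variables (sigma : set T -> R) (hba : ba Sigma sigma).
Hypothesis hm : forall A, Sigma A -> m A = (rvar Sigma sigma A)%:E.
Variables (P : set T) (SP : Sigma P).
Hypothesis hP :
  forall A, Sigma A -> (sigma A)%:E = (m (A `&` P) - m (A `\` P))%E.

Local Notation nu := (rvar Sigma sigma).

(** The density of [sigma] with respect to its variation. As a difference of indicators it is
    visibly simple. *)
Definition hahn_sign (x : T) : R := \1_P x - \1_(~` P) x.
Local Notation sg := hahn_sign.

Lemma hahn_signE x : sg x = if x \in P then 1 else -1.
Proof. by rewrite /sg !indicE in_setC; case: (x \in P); rewrite ?subr0 ?sub0r. Qed.

Lemma norm_hahn_sign x : `|sg x| = 1.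
Proof. by rewrite hahn_signE; case: ifP; rewrite ?normrN normr1. Qed.

Lemma hahn_sign_sqr x : sg x * sg x = 1.
Proof. by rewrite hahn_signE; case: ifP; rewrite ?mulrNN mulr1. Qed.

Lemma simple_hahn_sign : simple Sigma sg.
Proof. by apply: (simpleB hS); apply: (simple_indic hS) => //; exact: salgC. Qed.

Lemma Rintegral_indic A : Sigma A -> Int \1_A = nu A.
Proof.
move=> SA; rewrite -[RHS]/(fine (nu A)%:E) -hm// /Rintegral/=.
by rewrite integral_indic// setIT.
Qed.

Lemma sint_rvar s : simple Sigma s -> sint nu s = Int s.
Proof.
move=> hs; rewrite -(Rintegral_simple_mul integrable1)//.
  by apply: eq_Rintegral => x _; rewrite mulr1.
move=> A SA; rewrite -Rintegral_indic//.
by apply: eq_Rintegral => x _; rewrite mulr1.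
Qed.

Lemma sint_sigma s : simple Sigma s -> sint sigma s = Int (fun x => s x * sg x).
Proof.
have isg := integrable_simple simple_hahn_sign.
move=> hs; rewrite -(Rintegral_simple_mul isg)// => A SA.
have [SAP SAN] := (salgI hS SA SP, salgD hS SA SP).
have iP := integrable_simple (simple_indic hS SAP : simple Sigma (\1__ : T -> R)).
have iN := integrable_simple (simple_indic hS SAN : simple Sigma (\1__ : T -> R)).
rewrite (eq_Int (g := fun x => \1_(A `&` P) x - \1_(A `\` P) x)).
  rewrite RintegralB// !Rintegral_indic//; apply/EFin_inj.
  by rewrite hP// EFinB !hm.
move=> x; rewrite hahn_signE !indicE in_setD in_setI.
by case: (x \in A); case: (x \in P); rewrite /= ?mul1r ?mul0r ?subr0 ?sub0r ?oppr0.
Qed.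

(** Simple functions approximating [g] in the mean are determining for [f]: Chebyshev's inequality
    gives convergence in measure, the triangle inequality the Cauchy condition, and [|sg| = 1] the
    convergence of the integrals against [sigma]. The null set [N] is there because [f] itself may
    fail to be measurable. *)
Lemma integrable_determining f g N : Sigma N -> nu N = 0 ->
  (forall x, ~ N x -> f x = g x) -> integrable g ->
  mu_integrable Sigma sigma f /\
  mu_integral Sigma sigma f = Int (fun x => g x * sg x).
Proof.
move=> SN N0 fg ig; have [s [ss s0]] := Rintegral_approx ig.
have isk k := integrable_simple (ss k).
have idk k := integrable_dist ig (isk k).
have mg : measurable_fun setT (g : mT -> R).
  by apply/measurable_EFinP; exact: measurable_int ig.
have ms k := simple_measurable (ss k).
have det : determining_seq Sigma sigma s f.
  apply/(determining_seqP hS hba); split => //.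
    apply/(cvg_in_measureP hS hba) => e d e0 d0.
    have /cvgr0Pnorm_lt/(_ _ (mulr_gt0 e0 d0)) := s0.
    apply: filterS => k hk.
    pose A := [set x | e < `|g x - s k x|].
    have SA : Sigma A.
      have mgs : measurable_fun setT (fun x : mT => `|g x - s k x|).
        by apply: measurableT_comp => //; exact: measurable_funB.
      have := mgs measurableT _ (measurable_itv `]e, +oo[); rewrite setTI.
      rewrite (_ : _ @^-1` _ = A)//; apply/seteqP; split => x /=.
        by rewrite in_itv/= andbT.
      by rewrite in_itv/= andbT.
    exists (A `|` N); split; first exact: salgU.
      move=> x /= h; have [Nx|/fg fx] := pselect (N x); [by right|left].
      by rewrite /A/= distrC -fx.
    have anu : fin_additive Sigma nu by exact: rvar_fin_additive.
    have nu0 B : Sigma B -> 0 <= nu B by move=> _; exact: rvar_ge0.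
    apply: le_lt_trans (fin_additive_leU hS anu nu0 SA SN) _.
    (* Chebyshev: [e * nu A] is at most the integral of [|g - s k|], which is below [e * d]. *)
    rewrite N0 addr0 -(ltr_pM2l e0); apply: le_lt_trans hk.
    rewrite -Rintegral_indic// -RintegralZl//; last first.
      exact/integrable_simple/(simple_indic hS).
    rewrite ger0_norm; last exact: Rintegral_ge0.
    apply: le_Int => //.
      apply: integrable_simple; apply: (simpleZ hS).
      exact: simple_indic.
    move=> x; rewrite indicE; have [/set_mem Ax|_] := boolP (x \in A).
      by rewrite mulr1 ltW.
    by rewrite mulr0.
  move=> e e0; have e20 : 0 < e / 2 by rewrite divr_gt0.
  have /cvgr0Pnorm_lt/(_ _ e20)[K _ hK] := s0.
  exists K => k l Kk Kl; rewrite sint_rvar; last first.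
    exact/simple_norm/(simpleB hS).
  apply: (@le_lt_trans _ _ (Int (fun x => `|g x - s k x| + `|g x - s l x|))).
    apply: le_Int.
    - exact: integrable_dist.
    - exact: integrable_add.
    - by move=> x; rewrite (distrC (g x)); exact: ler_distD.
  rewrite RintegralD// [ltRHS]splitr ltrD//.
    by apply: le_lt_trans (hK k Kk); exact: ler_norm.
  by apply: le_lt_trans (hK l Kl); exact: ler_norm.
split; first by exists s.
have isg h : integrable h -> integrable (fun x => h x * sg x).
  move=> ih; under eq_fun do rewrite mulrC.
  by apply: integrable_simple_mul => //; exact: simple_hahn_sign.
apply: (mu_integralE hS hba det); apply/cvgrPdist_le => e e0.
have /cvgr0Pnorm_le/(_ e e0) := s0; apply: filterS => k hk.
apply: le_trans hk; rewrite sint_sigma// -RintegralB//; [|exact: isg..].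
apply: le_trans (le_normr_Rintegral _ _) _ => //.
  by apply: integrable_sub; exact: isg.
rewrite [leRHS]ger0_norm; last exact: Rintegral_ge0.
rewrite (eq_Int (g := fun x => `|g x - s k x|))//.
by move=> x; rewrite -mulrBl normrM norm_hahn_sign mulr1.
Qed.

End lebesgue.

(** * Measurable substitutes for limits in measure *)

Section representatives.
Context {R : realType} {T : Type} (Sigma : set (set T)).
Variables (hS : sigma_algebra setT Sigma) (x0 : T).
Local Notation mT := (salgType hS x0).
Implicit Types (A B N : set T) (f g s w : T -> R).
Variable m : {finite_measure set mT -> \bar R}.
Local Notation integrable f := (m.-integrable setT (EFin \o (f : mT -> R))).
Local Notation Int f := (\int[m]_(x in setT) (f : mT -> R) x).
Variables (sigma : set T -> R) (hba : ba Sigma sigma).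
Hypothesis hm : forall A, Sigma A -> m A = (rvar Sigma sigma A)%:E.
Local Notation nu := (rvar Sigma sigma).

Let anu : fin_additive Sigma nu. Proof. exact: rvar_fin_additive. Qed.

Let nu0 A : Sigma A -> 0 <= nu A. Proof. by move=> _; exact: rvar_ge0. Qed.

Lemma salg_lim_sup (A : (set T)^nat) : (forall k, Sigma (A k)) ->
  Sigma (lim_sup_set A).
Proof.
move=> SA; have mA k : measurable (A k : set mT) by [].
have : measurable (lim_sup_set A : set mT).
  by apply: bigcapT_measurable => n; exact: bigcup_measurable.
by [].
Qed.

(** Borel-Cantelli: the bounds are the terms of a series with sum at most 1. *)
Lemma rvar_lim_sup (A : (set T)^nat) : (forall k, Sigma (A k)) ->
  (forall k, nu (A k) < 1 / (2 ^ k.+1)%:R) -> nu (lim_sup_set A) = 0.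
Proof.
move=> SA hA; apply/EFin_inj; rewrite -hm; last exact: salg_lim_sup.
apply: lim_sup_set_cvg0 => //.
apply: le_lt_trans (le_trans _ (epsilon_trick0 xpredT ler01)) (ltry 1).
apply: lee_nneseries => // k _.
by apply: (@le_trans _ _ (nu (A k))%:E); [rewrite -hm|rewrite lee_fin ltW].
Qed.

(** The index [p j] is chosen so that the points with deviation above [1/(j+1)] lie in a set [A j]
    of variation below [2^-(j+1)]. Outside the limit superior of the [A j], which is null, the
    deviation is eventually at most [1/(j+1)]. The condition [j <= p j] suffices to reach tails of
    the sequence. *)
Lemma cvg_in_measure_subseq (F : (T -> R)^nat) f :
  cvg_in_measure Sigma sigma F f -> exists (p : nat -> nat) N,
    [/\ forall j, (j <= p j)%N, Sigma N, nu N = 0 &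
        forall x, ~ N x -> F (p j) x @[j --> \oo] --> f x].
Proof.
move=> /(cvg_in_measureP hS hba) Ff.
have /choice[p /choice[A hA]] j : exists k, exists A, [/\ (j <= k)%N, Sigma A,
    [set x | j.+1%:R^-1 < `|F k x - f x|] `<=` A & nu A < 1 / (2 ^ j.+1)%:R].
  have e0 : 0 < j.+1%:R^-1 :> R by rewrite invr_gt0.
  have d0 : 0 < 1 / (2 ^ j.+1)%:R :> R by rewrite divr_gt0// ltr0n expn_gt0.
  have [K _ hK] := Ff _ _ e0 d0.
  have [A [SA FA nA]] := hK (maxn j K) (leq_maxr _ _).
  by exists (maxn j K), A; split => //; exact: leq_maxl.
have SA j : Sigma (A j) by have [] := hA j.
exists p, (lim_sup_set A); split.
- by move=> j; have [] := hA j.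
- exact: salg_lim_sup.
- by apply: rvar_lim_sup => // j; have [] := hA j.
- move=> x /existsNP[J /not_implyP[_ hJ]].
  have close j : (J <= j)%N -> `|F (p j) x - f x| <= j.+1%:R^-1.
    move=> Jj; rewrite leNgt; apply/negP => h; apply: hJ; exists j => //.
    by have [_ _ + _] := hA j; apply.
  apply/cvgrPdist_le => e e0; near=> j.
  rewrite distrC; apply: le_trans (close j _) _.
    by near: j; exact: nbhs_infty_ge.
  by apply: ltW; near: j; exact: (near_infty_natSinv_lt (PosNum e0)).
Unshelve. all: by end_near. Qed.

Lemma measurable_cvg (F : (T -> R)^nat) f :
  (forall k, measurable_fun setT (F k : mT -> R)) ->
  (forall x, F k x @[k --> \oo] --> f x) -> measurable_fun setT (f : mT -> R).
Proof.
move=> mF Ff; apply/measurable_EFinP.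
apply: (@emeasurable_fun_cvg _ _ _ _ (fun k (x : mT) => (F k x)%:E)).
  by move=> k; exact/measurable_EFinP.
by move=> x _; apply: cvg_EFin; [exact: nearW|exact: Ff].
Qed.

(** Multiplying by the indicator of the complement of [N] turns convergence off [N] into convergence
    everywhere, so that the limit is measurable. *)
Lemma simple_measurable_subseq (F : (T -> R)^nat) f :
  (forall k, simple Sigma (F k)) -> cvg_in_measure Sigma sigma F f ->
  exists (p : nat -> nat) N g, [/\ forall j, (j <= p j)%N, Sigma N, nu N = 0,
    (forall x, ~ N x -> f x = g x) /\ measurable_fun setT (g : mT -> R) &
    forall x, F (p j) x * \1_(~` N) x @[j --> \oo] --> g x].
Proof.
move=> sF /cvg_in_measure_subseq[p [N [hp SN N0 hN]]].
exists p, N, (fun x => f x * \1_(~` N) x).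
have h x : F (p j) x * \1_(~` N) x @[j --> \oo] --> f x * \1_(~` N) x.
  rewrite indicE; have [/set_mem Nx|/negP Nx] := boolP (x \in ~` N).
    by under eq_fun do rewrite mulr1; rewrite mulr1; exact: hN.
  by under eq_fun do rewrite mulr0; rewrite mulr0; exact: cvg_cst.
split => //; split.
  by move=> x Nx; rewrite indicE mem_set// mulr1.
apply: (measurable_cvg _ h) => k; apply: simple_measurable.
by apply: (simpleM hS) => //; apply: (simple_indic hS); exact: salgC.
Qed.

Lemma measurable_representative f : mu_measurable Sigma sigma f ->
  exists g N, [/\ measurable_fun setT (g : mT -> R), Sigma N, nu N = 0 &
    forall x, ~ N x -> f x = g x].
Proof.
move=> [F [sF Ff]].
have [p [N [g [_ SN N0 [fg mg] _]]]] := simple_measurable_subseq sF Ff.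
by exists g, N.
Qed.

(** Fatou's lemma: the Cauchy condition bounds the integrals of [|F k|] for large [k], and this
    bound passes to the limit along the subsequence. *)
Lemma integrable_representative f : mu_integrable Sigma sigma f ->
  exists g N, [/\ integrable g, Sigma N, nu N = 0 &
    forall x, ~ N x -> f x = g x].
Proof.
move=> [F /(determining_seqP hS hba)[sF Ff Fc]].
have [p [N [g [hp SN N0 [fg mg] hg]]]] := simple_measurable_subseq sF Ff.
exists g, N; split => //.
have [K hK] := Fc 1 ltr01.
(* The shift ensures [K <= q j], so the Cauchy bound 1 applies to [F (q j) - F K]. *)
pose q j := p (j + K)%N.
pose h j x : R := `|F (q j) x * \1_(~` N) x|.
have sh j : simple Sigma (h j).
  by apply/simple_norm/(simpleM hS) => //; apply: (simple_indic hS); exact: salgC.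
have hC j : Int (h j) <= 1 + Int (fun x => `|F K x|).
  apply: (@le_trans _ _ (Int (fun x => `|F (q j) x - F K x| + `|F K x|))).
    have i1 : integrable (fun x => `|F (q j) x - F K x|).
      exact/integrable_simple/simple_norm/(simpleB hS).
    have i2 : integrable (fun x => `|F K x|) by exact/integrable_simple/simple_norm.
    apply: le_Int; [exact: integrable_simple|exact: integrable_add|].
    move=> x; rewrite /h normrM -[leRHS]mulr1.
    apply: ler_pM => //; last by rewrite indicE; case: (_ \in _); rewrite ?normr1 ?normr0.
    by rewrite -[in leLHS](subrK (F K x) (F (q j) x)) ler_normD.
  rewrite RintegralD//; last 2 first.
  - exact/integrable_simple/simple_norm/(simpleB hS).
  - exact/integrable_simple/simple_norm.
  rewrite lerD2r ltW// -(sint_rvar hm)//; last exact/simple_norm/(simpleB hS).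
  by apply: hK => //; rewrite (leq_trans _ (hp _))// leq_addl.
apply/integrableP; split; first exact/measurable_EFinP.
apply: (@le_lt_trans _ _ (1 + Int (fun x => `|F K x|))%:E); last exact: ltry.
have hcvg x : limn_einf (fun j => (h j x)%:E) = `|(EFin \o g) x|%E.
  have /cvg_limn_einf_sup[-> //] : (h j x)%:E @[j --> \oo] --> `|(g x)%:E|%E.
  apply: cvg_EFin; first exact: nearW.
  apply: cvg_norm; have := hg x; rewrite -(cvg_shiftn K); exact.
under eq_integral do rewrite -hcvg.
apply: le_trans (@fatou _ mT R m setT measurableT (fun j (x : mT) => (h j x)%:E) _ _) _.
- by move=> j; apply/measurable_EFinP; exact: simple_measurable.
- by move=> j x _; rewrite lee_fin /h.
rewrite limn_einf_lim; apply: lime_le; first exact: is_cvg_einfs.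
apply: nearW => j; apply: (@le_trans _ _ (\int[m]_x (h j x)%:E)%E).
  by apply: ereal_inf_lbound; exists j => /=.
have ih : (\int[m]_x (h j x)%:E)%E \is a fin_num.
  by apply: integrable_fin_num => //; exact: integrable_simple.
rewrite -(fineK ih) lee_fin; exact: hC.
Qed.

Lemma finite_int_itv (n : nat) :
  finite_set [set i : int | (- (n%:Z) <= i < n%:Z)%R].
Proof.
apply: (@sub_finite_set _ _ ((fun j : nat => j%:Z - n%:Z) @` `I_(n + n))).
  move=> i /= /andP[h1 h2]; exists (absz (i + n%:Z)); first by rewrite /=; lia.
  by lia.
exact/finite_image/finite_II.
Qed.

(** The values are rounded down to multiples of [1/(k+1)]: boundedness leaves finitely many
    integers, and each level set is the preimage of a half-open interval. *)
Lemma simple_floor g (b : R) k : measurable_fun setT (g : mT -> R) ->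
  (forall x, `|g x| <= b) ->
  simple Sigma (fun x => (Num.floor (k.+1%:R * g x))%:~R / k.+1%:R : R).
Proof.
move=> mg gb.
apply: (@simple_comp R T Sigma hS _ (fun x => Num.floor (k.+1%:R * g x))
  (fun i : int => i%:~R / k.+1%:R : R)).
  pose n := (Num.bound (k.+1%:R * b)).
  apply: sub_finite_set (finite_int_itv n) => _ [x _ <-] /=.
  have : `|k.+1%:R * g x| < n%:R.
    rewrite normrM ger0_norm//; apply: le_lt_trans (archi_boundP _).
      by rewrite ler_wpM2l.
    by rewrite mulr_ge0// (le_trans _ (gb x)).
  rewrite ltr_norml => /andP[h1 h2].
  rewrite floor_lt_int floor_ge_int intrN/= h2 andbT; exact: ltW.
move=> i.
have mkg : measurable_fun setT (fun x : mT => k.+1%:R * g x).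
  exact: measurable_funM.
have := mkg measurableT _ (measurable_itv `[i%:~R, (i + 1)%:~R[).
rewrite setTI; congr (Sigma _).
apply/seteqP; split => x /=; rewrite in_itv/= -floor_eq; first by move/eqP.
by move=> ->.
Qed.

Lemma dist_floor g k x :
  `|(Num.floor (k.+1%:R * g x))%:~R / k.+1%:R - g x| <= k.+1%:R^-1 :> R.
Proof.
have k0 : (0 : R) < k.+1%:R by [].
have /andP[h1 h2] := floor_itv (k.+1%:R * g x).
set y := Num.floor _ in h1 h2 *.
rewrite -[g x](mulKf (lt0r_neq0 k0)) [X in _ - X]mulrC -mulrBl normrM.
rewrite [`|_^-1|]ger0_norm// ler_piMl//.
rewrite distrC ger0_norm ?subr_ge0//.
by rewrite lerBlDl ltW// -[X in _ < _ + X]/(1%:~R) -intrD.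
Qed.

(** The measurable substitute is set to 0 on a null set containing the points where it differs from
    [f] or where [f] exceeds its essential bound. It is then bounded everywhere, and rounding it
    approximates it uniformly. *)
Lemma Linfty_approx f : mu_measurable Sigma sigma f ->
  ess_bounded Sigma sigma f -> exists g N b (s : (T -> R)^nat),
    [/\ measurable_fun setT (g : mT -> R) /\ (forall x, `|g x| <= b),
        Sigma N /\ nu N = 0, forall x, ~ N x -> f x = g x,
        forall k, simple Sigma (s k) &
        forall k x, `|s k x - g x| <= k.+1%:R^-1].
Proof.
move=> /measurable_representative[g [N [mg SN N0 fg]]] [M [A [SA A0 MA]]].
have SNA : Sigma (N `|` A) by exact: salgU.
pose h x : R := g x * \1_(~` (N `|` A)) x.
have mh : measurable_fun setT (h : mT -> R).
  apply: measurable_funM => //.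
  by apply: simple_measurable; apply: (simple_indic hS); exact: salgC.
(* [M] may be negative, namely when the whole space is null; its absolute value still bounds the
   value 0. *)
have hb x : `|h x| <= `|M|.
  rewrite /h indicE; have [/set_mem/not_orP[nN nA]|_] := boolP (_ \in _).
    rewrite mulr1 -fg// (le_trans _ (ler_norm M))// leNgt.
    by apply/negP => hx; apply: nA; exact: MA.
  by rewrite mulr0 normr0.
exists h, (N `|` A), `|M|,
  (fun k x => (Num.floor (k.+1%:R * h x))%:~R / k.+1%:R); split => //.
- split => //; apply/le_anti; rewrite nu0// andbT.
  apply: le_trans (fin_additive_leU hS anu nu0 SN SA) _.
  by rewrite N0 add0r /rvar A0.
- move=> x nNA; have /not_orP[nN _] := nNA.
  by rewrite /h fg// indicE mem_set// mulr1.
- by move=> k; exact: simple_floor mh hb.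
- by move=> k x; exact: dist_floor.
Qed.

End representatives.

(** * Yosida-Hewitt decomposition and pure measures *)

Section yosida_hewitt.
Context {R : realType} {T : Type} (Sigma : set (set T)).
Hypothesis hS : sigma_algebra setT Sigma.
Implicit Types (A B : set T) (mu nu a b : set T -> R) (F : (set T)^nat).

(** For an additive set function, countable additivity means that its values on these remainders
    tend to 0. *)
Definition tail F n := \bigcup_i F i `\` \big[setU/set0]_(i < n) F i.

Lemma salg_bigsetU F n : (forall i, Sigma (F i)) ->
  Sigma (\big[setU/set0]_(i < n) F i).
Proof.
by move=> SF; apply: big_ind => //; [exact: salg0|exact: salgU].
Qed.

Lemma salg_tail F n : (forall i, Sigma (F i)) -> Sigma (tail F n).
Proof.
by move=> SF; apply: (salgD hS); [exact: (salg_bigcup hS)|exact: salg_bigsetU].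
Qed.

Lemma series_tail mu F n : fin_additive Sigma mu -> (forall i, Sigma (F i)) ->
  trivIset setT F -> series (mu \o F) n = mu (\bigcup_i F i) - mu (tail F n).
Proof.
move=> amu SF tF; rewrite (fin_additiveD hS amu); last first.
- by rewrite -bigcup_mkord => x [i _ Fi]; exists i.
- exact: salg_bigsetU.
- exact: (salg_bigcup hS).
rewrite subKr /series/= big_mkord.
elim: n => [|n IH]; first by rewrite !big_ord0 (fin_additive0 hS amu).
rewrite !big_ord_recr/= amu ?IH//; first exact: salg_bigsetU.
rewrite -bigcup_mkord; apply/seteqP; split => // x [[i /= ni Fi] Fn].
have e : i = n by apply: tF => //; exists x.
by rewrite e ltnn in ni.
Qed.

Lemma countably_additiveP mu : fin_additive Sigma mu ->
  countably_additive Sigma mu <-> forall F, (forall i, Sigma (F i)) ->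
    trivIset setT F -> mu (tail F n) @[n --> \oo] --> (0 : R).
Proof.
move=> amu; have E F (SF : forall i, Sigma (F i)) (tF : trivIset setT F) :
    series (mu \o F) = (fun n => mu (\bigcup_i F i) - mu (tail F n)).
  by apply/funext => n; rewrite series_tail.
split=> h F SF tF.
  have := h F SF tF; rewrite E// => hF.
  rewrite -(subrr (mu (\bigcup_i F i))).
  rewrite (_ : (fun n => _) =
    (fun n => mu (\bigcup_i F i) - (mu (\bigcup_i F i) - mu (tail F n)))).
    by apply: cvgB => //; exact: cvg_cst.
  by apply/funext => n; rewrite subKr.
rewrite E// -[X in _ --> X]subr0; apply: cvgB; [exact: cvg_cst|exact: h].
Qed.

(** Real-valued version of [meas_meet]; for nonnegative [a], [b] and [A] in [Sigma] the set is
    nonempty and bounded below, so [inf] is not a default value. *)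
Definition rmeet a b A : R :=
  inf [set a B + b (A `\` B) | B in [set B | Sigma B /\ B `<=` A]].

Section rmeet.
Variables a b : set T -> R.
Hypotheses (aa : fin_additive Sigma a) (a0 : forall A, Sigma A -> 0 <= a A).
Hypotheses (ab : fin_additive Sigma b) (b0 : forall A, Sigma A -> 0 <= b A).

Let has_inf_rmeet A : Sigma A ->
  has_inf [set a B + b (A `\` B) | B in [set B | Sigma B /\ B `<=` A]].
Proof.
move=> SA; split.
  by exists (a A + b (A `\` A)), A; split.

exists 0 => _ [B [SB BA] <-]; rewrite addr_ge0 ?a0 ?b0//; exact: salgD.
Qed.

Lemma rmeet_le A B : Sigma A -> Sigma B -> B `<=` A ->
  rmeet a b A <= a B + b (A `\` B).
Proof.
by move=> SA SB BA; apply: ge_inf; [exact: (has_inf_rmeet SA).2|exists B].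
Qed.

Lemma rmeet_ge A x : Sigma A ->
  (forall B, Sigma B -> B `<=` A -> x <= a B + b (A `\` B)) -> x <= rmeet a b A.
Proof.
move=> SA h; apply: lb_le_inf; first exact: (has_inf_rmeet SA).1.
by move=> _ [B [SB BA] <-]; exact: h.
Qed.

Lemma rmeet_adherent A e : Sigma A -> 0 < e ->
  exists B, [/\ Sigma B, B `<=` A & a B + b (A `\` B) < rmeet a b A + e].
Proof.
move=> SA e0; have [_ [B [SB BA] <-] h] := inf_adherent e0 (has_inf_rmeet SA).
by exists B.
Qed.

Lemma rmeet_ge0 A : Sigma A -> 0 <= rmeet a b A.
Proof.
move=> SA; apply: rmeet_ge => // B SB BA; rewrite addr_ge0 ?a0 ?b0//.
exact: salgD.
Qed.

(** Nearly optimal splittings of [A] and [A'] unite to a splitting of the union, and every splitting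
    of the union restricts to [A] and to [A']. *)
Lemma rmeet_fin_additive : fin_additive Sigma (rmeet a b).
Proof.
move=> A A' SA SA' AA'; have SU := salgU hS SA SA'.
apply/le_anti/andP; split.
  apply/ler_addgt0Pr => e e0; have e20 : 0 < e / 2 by rewrite divr_gt0.
  have [B [SB BA hB]] := rmeet_adherent SA e20.
  have [B' [SB' BA' hB']] := rmeet_adherent SA' e20.
  apply: (@le_trans _ _ (a (B `|` B') + b ((A `\` B) `|` (A' `\` B')))).
    rewrite (_ : (A `\` B) `|` _ = (A `|` A') `\` (B `|` B')).
      by apply: rmeet_le => //; [exact: salgU|exact: setUSS].
    apply/seteqP; split => [x [[Ax nB]|[Ax nB]]|x [[Ax|Ax] /not_orP[nB nB']]].
    - by split; [left|move=> [//|/BA' A'x]; have : (A `&` A') x by []; rewrite AA'].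
    - by split; [right|move=> [/BA A'x|//]; have : (A `&` A') x by []; rewrite AA'].
    - by left.
    - by right.
  rewrite aa//; last first.
    by apply/seteqP; split => // x [/BA Ax /BA' A'x]; rewrite -AA'.
  rewrite ab; [|exact: salgD|exact: salgD|]; last first.
    by apply/seteqP; split => // x [[Ax _] [A'x _]]; rewrite -AA'.
  rewrite addrACA [e]splitr [leRHS]addrACA; apply: lerD; exact: ltW.
apply: rmeet_ge => // B SB BU.
have e1 : a B = a (B `&` A) + a (B `&` A').
  rewrite -aa; [|exact: salgI|exact: salgI|]; last first.
    by rewrite setIACA AA' setI0.
  by rewrite -setIUr; congr a; apply/esym/setIidPl.
have e2 : b ((A `|` A') `\` B) = b (A `\` (B `&` A)) + b (A' `\` (B `&` A')).
  rewrite -ab; last first.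
    by apply/seteqP; split => // x [[Ax _] [A'x _]]; rewrite -AA'.
  - by apply: (salgD hS) => //; exact: salgI.
  - by apply: (salgD hS) => //; exact: salgI.
  congr b; apply/seteqP; split => [x [[Ax|Ax] nB]|x [[Ax nB]|[Ax nB]]].
  - by left; split => // -[].
  - by right; split => // -[].
  - by split; [left|move=> Bx; apply: nB].
  - by split; [right|move=> Bx; apply: nB].
rewrite e1 e2 addrACA; apply: lerD; apply: rmeet_le => //; exact: salgI.
Qed.

Lemma rmeet_lel A : Sigma A -> rmeet a b A <= a A.
Proof.
move=> SA; apply: le_trans (rmeet_le SA SA _) _ => //.
by rewrite setDv (fin_additive0 hS ab) addr0.
Qed.

Lemma rmeet_ler A : Sigma A -> rmeet a b A <= b A.
Proof.
move=> SA; apply: le_trans (rmeet_le SA (salg0 hS) _) _ => //.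
by rewrite setD0 (fin_additive0 hS aa) add0r.
Qed.

End rmeet.

(** * The decomposition in the nonnegative case *)

Section nonnegative.
Variables mu nu : set T -> R.
Hypotheses (amu : fin_additive Sigma mu) (mu0 : forall A, Sigma A -> 0 <= mu A).
Hypotheses (anu : fin_additive Sigma nu) (nu0 : forall A, Sigma A -> 0 <= nu A).
Hypothesis cnu : countably_additive Sigma nu.

Let knu (k : nat) A : R := k%:R * nu A.

Let aknu k : fin_additive Sigma (knu k).
Proof. by move=> A B SA SB AB; rewrite /knu anu// mulrDr. Qed.

Let knu0 k A : Sigma A -> 0 <= knu k A.
Proof. by move=> SA; rewrite mulr_ge0// nu0. Qed.

Let rho k := rmeet mu (knu k).

Let rho_nd A : Sigma A -> nondecreasing_seq (fun k => rho k A).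
Proof.
move=> SA k l kl; apply: (rmeet_ge mu0 (@knu0 l)) => // B SB BA.
apply: le_trans (rmeet_le mu0 (@knu0 k) SA SB BA) _.
by rewrite lerD2l ler_wpM2r ?ler_nat//; apply: nu0; exact: salgD.
Qed.

Let rho_le k A : Sigma A -> rho k A <= mu A.
Proof. exact: (rmeet_lel mu0 (@aknu k) (@knu0 k)). Qed.

Let arho k : fin_additive Sigma (rho k).
Proof. exact: (rmeet_fin_additive amu mu0 (@aknu k) (@knu0 k)). Qed.

Let c A : R := lim (rho k A @[k --> \oo]).

Let rho_cvg A : Sigma A -> rho k A @[k --> \oo] --> c A.
Proof.
move=> SA; apply: (nondecreasing_is_cvgn (rho_nd SA)).
by exists (mu A) => _ [k _ <-]; exact: rho_le.
Qed.

Let rho_lec k A : Sigma A -> rho k A <= c A.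
Proof.
move=> SA; apply: (nondecreasing_cvgn_le (rho_nd SA)).
exact: rho_cvg.
Qed.

Let c_le A : Sigma A -> c A <= mu A.
Proof.
move=> SA; apply: (limr_le (rho_cvg SA)); apply: nearW => k; exact: rho_le.
Qed.

Let ac : fin_additive Sigma c.
Proof.
move=> A B SA SB AB; apply: (cvg_lim (@Rhausdorff R)).
rewrite (_ : (fun k => _) = (fun k => rho k A + rho k B)).
  by apply: cvgD; exact: rho_cvg.
by apply/funext => k; rewrite arho.
Qed.

(** [c - rho k] is nonnegative and additive, hence monotone: its value on [setT] bounds the error on
    every set, so [rho k] converges to [c] uniformly. *)
Let c_uniform k A : Sigma A -> c A - rho k A <= c setT - rho k setT.
Proof.
move=> SA; apply: (@fin_additive_le _ _ Sigma hS (fun A => c A - rho k A)) => //.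
- by move=> B B' SB SB' BB; rewrite ac// arho// opprD addrACA.
- by move=> B SB; rewrite subr_ge0 rho_lec.
- exact: salgT.
Qed.

(** [rho k] is small on remainders because it lies below [k * nu]; uniform convergence passes this
    on to [c]. *)
Let cc : countably_additive Sigma c.
Proof.
apply/countably_additiveP => // F SF tF; apply/cvgr0Pnorm_le => e e0.
have e20 : 0 < e / 2 by rewrite divr_gt0.
have /cvgrPdist_le/(_ _ e20)[k _ /(_ k (leqnn k)) hk] := rho_cvg (salgT hS).
have /cvgr0Pnorm_le hnu := (countably_additiveP anu).1 cnu F SF tF.
have k0 : 0 < k%:R + 1 :> R by rewrite ltr_wpDl.
apply: filterS (hnu _ (divr_gt0 e20 k0)) => n hn.
have St := salg_tail n SF.
rewrite ger0_norm; last first.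
  by rewrite (le_trans _ (rho_lec k St))//; exact: (rmeet_ge0 mu0 (@knu0 k)).
rewrite -(subrK (rho k (tail F n)) (c _)) [e]splitr; apply: lerD.
  by rewrite (le_trans (c_uniform k St))// (le_trans (ler_norm _)).
apply: le_trans (rmeet_ler amu mu0 (@knu0 k) St) _.
rewrite ger0_norm ?nu0// in hn; rewrite /knu.
apply: (@le_trans _ _ ((k%:R + 1) * nu (tail F n))).
  by rewrite ler_wpM2r ?nu0// lerDl ler01.
by rewrite mulrC -ler_pdivlMr.
Qed.

Let p A : R := mu A - c A.

Let p0 A : Sigma A -> 0 <= p A.
Proof. by move=> SA; rewrite subr_ge0 c_le. Qed.

Let ap : fin_additive Sigma p.
Proof. by move=> A B SA SB AB; rewrite /p amu// ac// opprD addrACA. Qed.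

(** For each [B], the meet of [p] and [nu] is at most [p B + nu (~B)], and [rho k setT] is at most
    [c B + k * nu (~B)]. The sum is [mu B + (k + 1) * nu (~B)], whose infimum is [rho k.+1 setT].
    The increments of the convergent sequence [rho k setT] tend to 0. *)
Let rmeet_p_le0 : rmeet p nu setT <= 0.
Proof.
have ST := salgT hS.
have h k : rmeet p nu setT <= rho k.+1 setT - rho k setT.
  rewrite lerBrDr; apply: (rmeet_ge mu0 (@knu0 k.+1)) => // B SB _.
  have SB' : Sigma (setT `\` B) by exact: salgD.
  have h1 := rmeet_le p0 nu0 ST SB (@subsetT _ _).
  have h2 : rho k setT <= c B + knu k (setT `\` B).
    rewrite -{1}(setDUK (@subsetT _ B)) arho//; last by rewrite setDIK.
    by apply: lerD; [exact: rho_lec|exact: (rmeet_ler amu mu0 (@knu0 k))].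
  apply: le_trans (lerD h1 h2) _.
  by rewrite /p /knu -natr1 mulrDl mul1r; lra.
have h0 : rho k.+1 setT - rho k setT @[k --> \oo] --> c setT - c setT.
  by apply: cvgB; [rewrite (cvg_shiftS (fun k => rho k setT))|]; exact: rho_cvg.
rewrite -(subrr (c setT)); rewrite -(cvg_lim (@Rhausdorff R) h0).
by apply: limr_ge; [apply: cvgP h0|apply: nearW].
Qed.

(** The last clause expresses that the meet of [b] and [nu] is 0 on [setT]: [B] is a splitting that
    nearly attains the infimum. *)
Lemma yosida_hewitt_nonneg : exists a b : set T -> R,
  [/\ fin_additive Sigma a /\ fin_additive Sigma b,
      (forall A, Sigma A -> 0 <= a A) /\ (forall A, Sigma A -> 0 <= b A),
      countably_additive Sigma a, forall A, Sigma A -> mu A = a A + b A &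
      forall e, 0 < e -> exists B, [/\ Sigma B, b B < e & nu (~` B) < e]].
Proof.
exists c, p; split => //.
- split => // A SA; apply: le_trans (rho_lec 0 SA); exact: (rmeet_ge0 mu0 (@knu0 0)).
- by move=> A SA; rewrite /p addrC subrK.
- move=> e e0; have [B [SB _]] := rmeet_adherent p0 nu0 (salgT hS) e0.
  move=> /lt_le_trans/(_ (_ : _ <= e)); rewrite gerDr setTD.
  move=> /(_ rmeet_p_le0) h; have nB := nu0 (salgC hS SB).
  exists B; split => //; apply: le_lt_trans h; first by rewrite lerDl.
  by rewrite lerDr p0.
Qed.

End nonnegative.

(** The nonnegative case is applied to the positive and negative parts of [mu]. Their sum is [|mu|],
    so [c] and [p] are dominated by [|mu|] and vanish on its null sets. *)
Lemma yosida_hewitt mu nu : ba Sigma mu ->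
  fin_additive Sigma nu -> (forall A, Sigma A -> 0 <= nu A) ->
  countably_additive Sigma nu -> exists c p : set T -> R,
  [/\ ba Sigma c /\ countably_additive Sigma c, ba Sigma p,
      forall A, Sigma A -> mu A = c A + p A,
      forall A, Sigma A -> `|c A| <= rvar Sigma mu A /\ `|p A| <= rvar Sigma mu A &
      forall e, 0 < e ->
        exists B, [/\ Sigma B, rvar Sigma p B < e & nu (~` B) < e]].
Proof.
move=> hmu anu nu0 cnu; have amu := hmu.1.
have av := rvar_fin_additive hS hmu.
pose mup A : R := (rvar Sigma mu A + mu A) / 2.
pose mun A : R := (rvar Sigma mu A - mu A) / 2.
have amup : fin_additive Sigma mup.
  by move=> A B SA SB AB; rewrite /mup av// amu//; field.
have amun : fin_additive Sigma mun.
  by move=> A B SA SB AB; rewrite /mun av// amu//; field.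
have mup0 A : Sigma A -> 0 <= mup A.
  move=> SA; have := le_abs_rvar hS hmu SA; rewrite ler_norml => /andP[h1 h2].
  by rewrite divr_ge0//; lra.
have mun0 A : Sigma A -> 0 <= mun A.
  move=> SA; have := le_abs_rvar hS hmu SA; rewrite ler_norml => /andP[h1 h2].
  by rewrite divr_ge0//; lra.
have [a [b [[aa ab] [a0 b0] ca abE Zb]]] :=
  yosida_hewitt_nonneg amup mup0 anu nu0 cnu.
have [a' [b' [[aa' ab'] [a0' b0'] ca' abE' Zb']]] :=
  yosida_hewitt_nonneg amun mun0 anu nu0 cnu.
have bound A : Sigma A ->
    a A + a' A <= rvar Sigma mu A /\ b A + b' A <= rvar Sigma mu A.
  move=> SA; have := abE A SA; have := abE' A SA; rewrite /mup /mun.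
  by have := (a0 _ SA, a0' _ SA, b0 _ SA, b0' _ SA) => -[[[]]]; split; lra.
have rT A : Sigma A -> rvar Sigma mu A <= rvar Sigma mu setT.
  by move=> SA; exact: le_rvar.
have hc A : Sigma A -> `|a A - a' A| <= rvar Sigma mu A.
  move=> SA; have [h _] := bound A SA; apply: le_trans (ler_normB _ _) _.
  by rewrite !ger0_norm ?a0 ?a0'.
have hp' A : Sigma A -> `|b A - b' A| <= b A + b' A.
  by move=> SA; apply: le_trans (ler_normB _ _) _; rewrite !ger0_norm ?b0 ?b0'.
have hp A : Sigma A -> `|b A - b' A| <= rvar Sigma mu A.
  by move=> SA; have [_ h] := bound A SA; apply: le_trans h; exact: hp'.
have bap : ba Sigma (fun A => b A - b' A).
  split; last by exists (rvar Sigma mu setT) => A SA; rewrite (le_trans (hp A SA))// rT.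
  by move=> A B SA SB AB; rewrite ab// ab'// opprD addrACA.
exists (fun A => a A - a' A), (fun A => b A - b' A); split => //.
- split; first split.
  + by move=> A B SA SB AB; rewrite aa// aa'// opprD addrACA.
  + by exists (rvar Sigma mu setT) => A SA; rewrite (le_trans (hc A SA))// rT.
  + move=> F SF tF.
    rewrite (_ : series _ = series (a \o F) \- series (a' \o F)).
      by apply: cvgB; [exact: ca|exact: ca'].
    by apply/funext => n; rewrite /series/= sumrB.
- by move=> A SA; have := abE A SA; have := abE' A SA; rewrite /mup /mun; lra.
- by move=> A SA; split; [exact: hc|exact: hp].
- move=> e e0; have e20 : 0 < e / 2 by rewrite divr_gt0.
  have [B [SB bB nB]] := Zb _ e20; have [B' [SB' bB' nB']] := Zb' _ e20.
  have SBB := salgI hS SB SB'.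
  (* Shrinking keeps both nonnegative pieces of [p] small, while the complement is a union of two
     sets small for [nu]. *)
  exists (B `&` B'); split => //.
    have abb : fin_additive Sigma (fun A => b A + b' A).
      by move=> A A' SA SA' AA; rewrite ab// ab'// addrACA.
    apply: le_lt_trans (le_rvar_fin_additive hS bap SBB abb _) _.
      by move=> C SC _; exact: hp'.
    rewrite [e]splitr ltrD//.
      by apply: le_lt_trans bB; exact: (fin_additive_le hS).
    by apply: le_lt_trans bB'; exact: (fin_additive_le hS).
  rewrite setCI; apply: le_lt_trans (fin_additive_leU hS anu nu0 _ _) _.
  + exact: salgC.
  + exact: salgC.
  by rewrite [e]splitr ltrD.
Qed.

End yosida_hewitt.

(** * A criterion for purity, and rigidity of pure measures *)

Section pure.
Context {R : realType} {T : Type} (Sigma : set (set T)).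
Variables (hS : sigma_algebra setT Sigma) (x0 : T).
Local Notation mT := (salgType hS x0).
Implicit Types (A B N : set T) (mu lam sigma : set T -> R).

Lemma rvar_countably_additive lam : sigma_measure Sigma lam ->
  countably_additive Sigma (rvar Sigma lam).
Proof.
move=> /(sigma_measure_variation hS x0)[m [P [_ _ hm _]]] F SF tF.
have SU := salg_bigcup hS SF.
suff : EFin \o series (rvar Sigma lam \o F) @ \oo -->
    (rvar Sigma lam (\bigcup_i F i))%:E by move=> /fine_cvgP[].
rewrite -hm// (_ : EFin \o _ = fun n => (\sum_(0 <= i < n) m (F i))%E).
  exact: (@measure_semi_sigma_additive _ _ _ m F SF tF SU).
apply/funext => n; rewrite /series/= -sumEFin.
by apply: eq_bigr => i _; rewrite -hm.
Qed.

Lemma rvar_cvg0 lam (E : (set T)^nat) : sigma_measure Sigma lam ->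
  (forall j, Sigma (E j)) -> (forall j k, (j <= k)%N -> E k `<=` E j) ->
  \bigcap_j E j = set0 -> rvar Sigma lam (E j) @[j --> \oo] --> (0 : R).
Proof.
move=> hlam SE dE E0.
have [m [P [bal _ hm _]]] := sigma_measure_variation hS x0 hlam.
have mE j : measurable (E j : set mT) by exact: SE.
suff : EFin \o (fun j => rvar Sigma lam (E j)) @ \oo --> 0%E.
  by move=> /fine_cvgP[].
rewrite (_ : EFin \o _ = m \o E); last first.
  by apply/funext => j /=; rewrite -hm.
rewrite -(measure0 m) -E0; apply: nonincreasing_cvg_mu => //.
- have := ltry (rvar Sigma lam (E 0%N)); rewrite -hm//.
- by rewrite E0.
- by move=> j k jk; apply/subsetPset; exact: dE.
Qed.

Lemma weakly_ac_rvar sigma mu A : fin_additive Sigma sigma ->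
  ba_wrt Sigma sigma mu -> Sigma A ->
  variation Sigma sigma A = 0%E -> variation Sigma mu A = 0%E.
Proof.
move=> asig [bmu wmu] SA A0; apply/variation_eq0P => B SB BA; apply: wmu => //.
by apply/le_anti; rewrite variation_ge0 andbT -A0 le_variation.
Qed.

(** With [B j] taken for the tolerance [2^-(j+1)], the limit superior [N] of the complements is null
    for [sigma], hence for [mu]; the intersection [D j] of the later [B k] is null for [mu] because
    it lies in sets of arbitrarily small variation. The [D j] exhaust the complement of [N], so what
    [N] and [D j] leave of [A] decreases to the empty set and its [|lam|] tends to 0. *)
Lemma pure_approx sigma mu : sigma_measure Sigma sigma ->
  ba_wrt Sigma sigma mu ->
  (forall e, 0 < e -> exists B,
     [/\ Sigma B, rvar Sigma mu B < e & rvar Sigma sigma (~` B) < e]) ->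
  pure Sigma mu.
Proof.
move=> hsig wmu Z; have [bmu _] := wmu; split => // lam [hlam bal] A SA.
have [m [_ [bsig _ hm _]]] := sigma_measure_variation hS x0 hsig.
have e0 j : 0 < 1 / (2 ^ j.+1)%:R :> R by rewrite divr_gt0// ltr0n expn_gt0.
have /choice[B hB] j := Z _ (e0 j).
have SB j : Sigma (B j) by have [] := hB j.
pose N := lim_sup_set (fun j => ~` B j).
have SN : Sigma N by apply: (salg_lim_sup hS x0) => j; exact: salgC.
have N0 : variation Sigma mu N = 0%E.
  apply: (weakly_ac_rvar hsig.1 wmu SN); rewrite -rvarE//; congr EFin.
  apply: (rvar_lim_sup hm) => j; first exact: salgC.
  by have [] := hB j.
pose D j := \bigcap_(k >= j) B k.
have SD j : Sigma (D j).
  have : measurable (D j : set mT).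
    by apply: bigcap_measurable; [exists j => /=|move=> k _; exact: SB].
  by [].
have D0 j : variation Sigma mu (D j) = 0%E.
  rewrite -rvarE//; congr EFin; apply/le_anti; rewrite rvar_ge0 andbT.
  apply/ler_addgt0Pr => e ee; rewrite add0r.
  have [K _ hK] := near_infty_natSinv_lt (PosNum ee).
  (* The index has to be at least [j] for the inclusion and at least [K] for the tolerance to fall
     below [e]. *)
  have kD : D j `<=` B (maxn j K) by move=> x; apply; exact: leq_maxl.
  apply: le_trans (le_rvar hS bmu kD) _.
  have [_ /ltW h _] := hB (maxn j K); apply: le_trans h _.
  apply: le_trans (ltW (hK (maxn j K) (leq_maxr _ _))).
  by rewrite div1r lef_pV2 ?posrE ?ltr0n ?expn_gt0// ler_nat ltnW// ltn_expl.
pose E j := A `\` (N `|` D j).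
have SE j : Sigma (E j) by apply: salgD => //; exact: salgU.
have dE j k : (j <= k)%N -> E k `<=` E j.
  move=> jk x [Ax nx]; split => // -[Nx|Dx]; apply: nx; [by left|right].
  by move=> l /= kl; apply: Dx; exact: leq_trans kl.
have E0 : \bigcap_j E j = set0.
  apply/seteqP; split => // x hx; have [Ax nx] := hx 0%N I.
  have nN : ~ N x by move=> Nx; apply: nx; left.
  move: nN => /existsNP[J /not_implyP[_ hJ]].
  have [_] := hx J I; apply; right => k /= Jk; apply: contrapT => nB.
  by apply: hJ; exists k.
have /cvgr0Pnorm_lt hE := rvar_cvg0 hlam SE dE E0.
apply/le_anti/andP; split; last first.
  by apply: le_ereal_inf_tmp => _ [C _ <-]; rewrite adde_ge0// variation_ge0.
apply/lee_addgt0Pr => e ee; rewrite add0e.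
have [j _ /(_ j (leqnn j)) hj] := hE _ ee.
have SND : Sigma (A `&` (N `|` D j)) by apply: salgI => //; exact: salgU.
apply: (@le_trans _ _ (variation Sigma mu (A `&` (N `|` D j)) +
    variation Sigma lam (A `\` (A `&` (N `|` D j))))%E).
  by apply: ereal_inf_lbound; exists (A `&` (N `|` D j)).
rewrite setDIr setDv set0U.
have -> : variation Sigma mu (A `&` (N `|` D j)) = 0%E.
  apply/le_anti; rewrite variation_ge0 andbT.
  apply: le_trans (le_variation _ _ (@subIsetr _ _ _)) _.
  by apply: le_trans (variationU hS _ bmu.1 SN) _; rewrite N0 D0 adde0.
rewrite add0e -(rvarE hS (conj hlam.1 bal)) lee_fin ltW//.
by apply: le_lt_trans hj; exact: ler_norm.
Qed.

(** Purity of [mu] on [A], then of [mu'] on the resulting [C], leaves a set [D] on which both are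
    small, while [lam] is small on the two pieces cut off. On [D] itself [lam] is [mu - mu'], which
    makes four terms below [e / 4]. *)
Lemma pure_sub_sigma_measure mu mu' lam : pure Sigma mu -> pure Sigma mu' ->
  ca Sigma lam -> (forall A, Sigma A -> lam A = mu A - mu' A) ->
  forall A, Sigma A -> lam A = 0.
Proof.
move=> [bmu pmu] [bmu' pmu'] clam lamE A SA; have bl : ba Sigma lam.
  by case: clam => -[].
have key nu B e : ba Sigma nu -> 0 < e -> Sigma B ->
    meas_meet Sigma (variation Sigma nu) (variation Sigma lam) B = 0%E ->
    exists C, [/\ Sigma C, C `<=` B, rvar Sigma nu C < e &
      rvar Sigma lam (B `\` C) < e].
  move=> bnu e0 SB h.
  have /ereal_inf_lt[_ [C [SC CB] <-]] :
      (meas_meet Sigma (variation Sigma nu) (variation Sigma lam) B < e%:E)%E.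
    by rewrite h lte_fin.
  rewrite -!rvarE// -EFinD lte_fin => hC; exists C; split => //.
    by apply: le_lt_trans hC; rewrite lerDl rvar_ge0.
  by apply: le_lt_trans hC; rewrite lerDr rvar_ge0.
apply/eqP; rewrite -normr_le0; apply/ler_addgt0Pr => e e0; rewrite add0r.
have e40 : 0 < e / 4 by rewrite divr_gt0.
have [C [SC CA muC lC]] := key mu A _ bmu e40 SA (pmu lam clam A SA).
have [D [SD DC muD lD]] := key mu' C _ bmu' e40 SC (pmu' lam clam C SC).
have h1 : `|lam (A `\` C)| < e / 4.
  by apply: le_lt_trans lC; apply: (le_abs_rvar hS) => //; exact: salgD.
have h2 : `|lam (C `\` D)| < e / 4.
  by apply: le_lt_trans lD; apply: (le_abs_rvar hS) => //; exact: salgD.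
have h3 : `|mu D| < e / 4.
  apply: le_lt_trans muC; apply: le_trans (le_abs_rvar hS bmu SD) _.
  exact: le_rvar.
have h4 : `|mu' D| < e / 4 by apply: le_lt_trans muD; exact: le_abs_rvar.
rewrite (fin_additiveID hS bl.1 SA SC) (setIidr CA).
rewrite (fin_additiveID hS bl.1 SC SD) (setIidr DC) (lamE D)//.
apply: le_trans (ler_normD _ _) _.
apply: le_trans (lerD (ler_normD _ _) (lexx _)) _.
apply: le_trans (lerD (lerD (ler_normB _ _) (lexx _)) (lexx _)) _.
lra.
Qed.

End pure.

(** * Functionals on Linfty *)

Section Linfty_functional.
Context {R : realType} {T : Type} (Sigma : set (set T)).
Variables (hS : sigma_algebra setT Sigma) (sigma : set T -> R).
Variables (hsigma : sigma_measure Sigma sigma).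
Implicit Types (A : set T) (f g s : T -> R).

(** A predicate on functions, so that limits and sums are handled before passing to the quotient. *)
Definition Linfty_class f :=
  mu_measurable Sigma sigma f /\ ess_bounded Sigma sigma f.

Definition Linfty_pi f (hf : Linfty_class f) : Linfty hS hsigma :=
  \pi_(Linfty hS hsigma)%qT (MkLinfty (asboolT hf)).

Lemma Linfty_classP (f : Linfty hS hsigma) : Linfty_class f.
Proof. by have /asboolP := Linfty_valP (repr f). Qed.

Lemma Linfty_pi_repr f (hf : Linfty_class f) :
  ae_equal Sigma sigma (Linfty_pi hf) f.
Proof. exact: (Linfty_repr_pi hS hsigma (MkLinfty (asboolT hf))). Qed.

Lemma Linfty_reprK (f : Linfty hS hsigma) : Linfty_pi (Linfty_classP f) = f.
Proof.
rewrite -[RHS]reprK; congr (\pi_(Linfty hS hsigma)%qT _).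
exact: val_inj.
Qed.

Lemma Linfty_classD f g : Linfty_class f -> Linfty_class g ->
  Linfty_class (fun x => f x + g x).
Proof.
move=> [mf bf] [mg bg].
by split; [exact: (mu_measurableD hS hsigma.1)|exact: (ess_boundedD hS hsigma)].
Qed.

Lemma Linfty_classZ c f : Linfty_class f -> Linfty_class (fun x => c * f x).
Proof. by move=> [mf bf]; split; [exact: mu_measurableZ|exact: ess_boundedZ]. Qed.

Lemma simple_Linfty_class s : simple Sigma s -> Linfty_class s.
Proof.
move=> hs; split.
  exists (fun=> s); split => // e e0.
  apply/ge0_cvge0P => [k|d d0]; first exact: outer_variation_ge0.
  apply: nearW => k; apply/outer_variation_lt; exists set0; split.
  - exact: salg0.
  - by move=> x /=; rewrite subrr normr0 ltNge ltW.
  - rewrite (_ : variation _ _ _ = 0%E) ?lte_fin//.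
    apply/variation_eq0P => B _; rewrite subset0 => ->.
    exact: (fin_additive0 hS hsigma.1).
have [b b0 hb] := simple_bounded_norm hs; exists b.
apply: null_subset (null_set0 hS hsigma) => x /=.
by rewrite ltNge hb.
Qed.

Variable u : {linear Linfty hS hsigma -> R^o}.

Lemma Linfty_pi_add f g (hf : Linfty_class f) (hg : Linfty_class g)
  (hfg : Linfty_class (fun x => f x + g x)) :
  u (Linfty_pi hfg) = u (Linfty_pi hf) + u (Linfty_pi hg).
Proof.
rewrite -linearD; congr (u _); apply: etrans (esym (LinftyD_pi _ _ _ _)).
by congr (\pi_(Linfty hS hsigma)%qT _); exact: val_inj.
Qed.

Lemma Linfty_pi_scale c f (hf : Linfty_class f)
  (hcf : Linfty_class (fun x => c * f x)) :
  u (Linfty_pi hcf) = c * u (Linfty_pi hf).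
Proof.
transitivity (u (c *: Linfty_pi hf)); last exact: linearZ_LR.
congr (u _); apply: etrans (esym (LinftyZ_pi _ _ _ _)).
by congr (\pi_(Linfty hS hsigma)%qT _); exact: val_inj.
Qed.

Hypothesis hu : continuous u.

(** [linear_boundedP] allows every constant above some [C], which may be negative; [|C| + 1] is a
    nonnegative choice. *)
Lemma continuous_Linfty_bounded : exists2 C : R, 0 <= C &
  forall f (hf : Linfty_class f), `|u (Linfty_pi hf)| <= C * ess_norm Sigma sigma f.
Proof.
have /linear_boundedP [C [_ hC]] := (linear_bounded_continuous u).2 hu.
exists (`|C| + 1); first by rewrite addr_ge0.
move=> f hf; have C1 : C < `|C| + 1 by rewrite ltr_pwDr//; exact: ler_norm.
rewrite -(Linfty_norm_pi hS hsigma (MkLinfty (asboolT hf))).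
exact: (hC _ C1 (Linfty_pi hf)).
Qed.

End Linfty_functional.

Section L1_class.
Context {R : realType} {T : Type} (Sigma : set (set T)).
Variables (hS : sigma_algebra setT Sigma) (sigma : set T -> R).
Variables (hsigma : sigma_measure Sigma sigma).
Implicit Types (f g : T -> R).

Lemma L1_val_integrable (h : L1 hS hsigma) : mu_integrable Sigma sigma h.
Proof. by have /asboolP := L1_valP (repr h). Qed.

Lemma L1_ae_eq (h h' : L1 hS hsigma) : ae_equal Sigma sigma h h' -> h = h'.
Proof.
move=> hh; rewrite -[h]reprK -[h']reprK.
by apply/eqmodP/asboolP.
Qed.

Lemma L1_pi_ex f : mu_integrable Sigma sigma f ->
  exists h : L1 hS hsigma, ae_equal Sigma sigma h f.
Proof.
move=> hf; exists (\pi_(L1 hS hsigma)%qT (MkL1 (asboolT hf))).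
have : \pi_(L1 hS hsigma)%qT (repr (\pi_(L1 hS hsigma)%qT (MkL1 (asboolT hf)))) =
  \pi_(L1 hS hsigma)%qT (MkL1 (asboolT hf)) by rewrite reprK.
by move=> /eqmodP/asboolP.
Qed.

(** Convertible to the local [represents] of the theorem; stated apart so that existence and
    uniqueness can be separate lemmas. *)
Definition represents (u : Linfty hS hsigma -> R) (mu_p : set T -> R)
    (h : L1 hS hsigma) :=
  [/\ ba_wrt Sigma sigma mu_p, pure Sigma mu_p &
      forall f : Linfty hS hsigma,
        [/\ mu_integrable Sigma sigma (fun x => f x * h x),
            mu_integrable Sigma mu_p f &
            u f = mu_integral Sigma sigma (fun x => f x * h x)
                  + mu_integral Sigma mu_p f]].

End L1_class.

(** * The empty carrier *)

Section empty.
Context {R : realType} {T : Type} (Sigma : set (set T)).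
Variables (hS : sigma_algebra setT Sigma) (sigma : set T -> R).
Variables (hsigma : sigma_measure Sigma sigma).
Hypothesis T0 : forall x : T, False.

Let set_empty (A : set T) : A = set0.
Proof. by apply/seteqP; split => x; have := T0 x. Qed.

Let fun_empty (f g : T -> R) : f = g.
Proof. by apply/funext => x; have := T0 x. Qed.

(** All functions coincide and every additive set function is 0, so each integral is 0 and [u] can
    only be evaluated at 0. *)
Lemma represents_empty (u : {linear Linfty hS hsigma -> R^o}) :
  exists mu_p h, represents u mu_p h /\ forall mu_p' h', represents u mu_p' h' ->
    (forall A, Sigma A -> mu_p' A = mu_p A) /\ h' = h.
Proof.
have ae0 (f g : T -> R) : ae_equal Sigma sigma f g.
  by rewrite (fun_empty f g); exact: ae_equal_refl.
have ba0 (mu : set T -> R) : fin_additive Sigma mu -> ba Sigma mu.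
  move=> amu; split => //; exists 0 => A _.
  by rewrite (set_empty A) (fin_additive0 hS amu) normr0.
have var0 (mu : set T -> R) A : fin_additive Sigma mu -> variation Sigma mu A = 0%E.
  move=> amu; apply/variation_eq0P => B _ _.
  by rewrite (set_empty B) (fin_additive0 hS amu).
have int0 (mu : set T -> R) f : fin_additive Sigma mu ->
    mu_integrable Sigma mu f /\ mu_integral Sigma mu f = 0.
  move=> amu; have bmu := ba0 _ amu.
  have d : determining_seq Sigma mu (fun _ _ => 0) f.
    apply: (determining_uniform hS bmu (salg0 hS)).
    - by rewrite /rvar var0.
    - by move=> k; exact: simple_cst.
    - by move=> k x; have := T0 x.
  split; first by exists (fun _ _ => 0).
  apply: (mu_integralE hS bmu d); rewrite (sint_cst hS amu) mul0r.
  exact: cvg_cst.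
have a0 : fin_additive Sigma (fun _ => 0 : R) by move=> A B _ _ _; rewrite addr0.
have [h _] := L1_pi_ex hS hsigma (int0 sigma (fun=> 0) hsigma.1).1.
exists (fun=> 0), h; split; last first.
  move=> mu_p' h' [[[amu _] _] _ _]; split; last exact: L1_ae_eq.
  by move=> A _; rewrite (set_empty A) (fin_additive0 hS amu).
split => //; first by split => //; exact: ba0.
  split; first exact: ba0.
  move=> nu [[anu _] _] A _; apply/le_anti/andP; split.
    apply: ereal_inf_lbound; exists set0; first by split => //; exact: salg0.
    by rewrite !var0// adde0.
  by apply: le_ereal_inf_tmp => _ [B _ <-]; rewrite !var0// adde0.
move=> f; have [i1 e1] := int0 sigma (fun x => f x * h x) hsigma.1.
have [i2 e2] := int0 _ f a0; split => //; rewrite e1 e2 addr0.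
rewrite -(linear0 u); congr (u _); rewrite -[f]reprK; exact/Linfty_piP.
Qed.

End empty.

(** * Uniqueness and existence on a nonempty carrier *)

Section inhabited.
Context {R : realType} {T : Type} (Sigma : set (set T)).
Variables (hS : sigma_algebra setT Sigma) (x0 : T) (sigma : set T -> R).
Local Notation mT := (salgType hS x0).
Variables (hsigma : sigma_measure Sigma sigma).
Implicit Types (A B N : set T) (f g s w : T -> R).
Variable m : {finite_measure set mT -> \bar R}.
Variables (hba : ba Sigma sigma).
Hypothesis hm : forall A, Sigma A -> m A = (rvar Sigma sigma A)%:E.
Variables (P : set T) (SP : Sigma P).
Hypothesis hP :
  forall A, Sigma A -> (sigma A)%:E = (m (A `&` P) - m (A `\` P))%E.
Local Notation integrable f := (m.-integrable setT (EFin \o (f : mT -> R))).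
Local Notation Int f := (\int[m]_(x in setT) (f : mT -> R) x).
Local Notation nu := (rvar Sigma sigma).
Local Notation sg := (hahn_sign P).

Let anu : fin_additive Sigma nu. Proof. exact: rvar_fin_additive. Qed.

Let nu0 A : Sigma A -> 0 <= nu A. Proof. by move=> _; exact: rvar_ge0. Qed.

Lemma null_rvar N : null Sigma sigma N ->
  exists A, [/\ Sigma A, nu A = 0 & N `<=` A].
Proof. by move=> [A [SA A0 NA]]; exists A; split => //; rewrite /rvar A0. Qed.

Lemma rvar_null_variation A : nu A = 0 -> variation Sigma sigma A = 0%E.
Proof. by move=> A0; rewrite -(rvarE hS hba) A0. Qed.

Lemma rvarU0 A B : Sigma A -> Sigma B -> nu A = 0 -> nu B = 0 -> nu (A `|` B) = 0.
Proof.
move=> SA SB A0 B0; apply/le_anti; rewrite rvar_ge0 andbT.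
by apply: le_trans (fin_additive_leU hS anu nu0 SA SB) _; rewrite A0 B0 addr0.
Qed.

Lemma rvar_wrt mu A : ba_wrt Sigma sigma mu -> Sigma A -> nu A = 0 ->
  rvar Sigma mu A = 0.
Proof.
move=> wmu SA A0.
by rewrite /rvar (weakly_ac_rvar hsigma.1 wmu SA)//; exact: rvar_null_variation.
Qed.

Lemma integrable_mul_sign g : integrable g -> integrable (fun x => g x * sg x).
Proof.
move=> ig; under eq_fun do rewrite mulrC.
by apply: integrable_simple_mul => //; exact: simple_hahn_sign.
Qed.

Lemma countably_additive_density (lam : set T -> R) w : integrable w ->
  (forall A, Sigma A -> lam A = Int (fun x => \1_A x * w x)) ->
  countably_additive Sigma lam.
Proof.
move=> iw lamE F SF tF.
suff : EFin \o series (lam \o F) @ \oo --> (lam (\bigcup_i F i))%:E.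
  by move=> /fine_cvgP[].
pose ic : {charge set mT -> \bar R} := induced_charge iw.
have E A : Sigma A -> (lam A)%:E = ic A.
  move=> SA; rewrite lamE// Rintegral_indic_mul//= /Rintegral/= fineK//.
  apply: integrable_fin_num => //; exact: (integrableS measurableT).
have SU := salg_bigcup hS SF.
rewrite E// (_ : EFin \o _ = fun n => (\sum_(0 <= i < n) ic (F i))%E).
  exact: (@charge_semi_sigma_additive _ _ _ ic F SF tF SU).
apply/funext => n; rewrite /series/= -sumEFin.
by apply: eq_bigr => i _; exact: E.
Qed.

(** The Radon-Nikodym derivative is finite at every point, so [fine] changes nothing. *)
Lemma radon_nikodym_real (c : set T -> R) : sigma_measure Sigma c ->
  (forall A, Sigma A -> nu A = 0 -> c A = 0) ->
  exists2 g, integrable g & forall A, Sigma A -> Int (fun x => \1_A x * g x) = c A.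
Proof.
move=> hc c0; pose cc : {charge set mT -> \bar R} := @sigma_charge _ _ _ hS x0 _ hc.
have dom : cc `<< m.
  apply/null_content_dominatesP => A SA mA0; rewrite /cc/= /sigma_charge c0//.
  by apply/EFin_inj; rewrite -hm.
pose g (x : T) : R := fine (Radon_Nikodym cc m x).
have gE : EFin \o (g : mT -> R) = Radon_Nikodym cc m.
  by apply/funext => x /=; rewrite fineK// Radon_Nikodym_fin_num.
exists g; first by rewrite gE; exact: Radon_Nikodym_integrable.
move=> A SA; rewrite Rintegral_indic_mul// /Rintegral.
rewrite (_ : (fun x => (g x)%:E) = Radon_Nikodym cc m) -?gE//.
by rewrite gE -(Radon_Nikodym_integral dom).
Qed.

(** The representation tested on indicators. The representative of the class of [\1_A] may differ
    from [\1_A] on a null set [B]; the constant sequence [\1_A] is still determining for it, with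
    [B] as exceptional set. *)
Lemma represents_ae (u : Linfty hS hsigma -> R) mu_p (h : L1 hS hsigma) g N A
  (hA : Linfty_class Sigma sigma \1_A) :
  represents u mu_p h -> integrable g -> Sigma N -> nu N = 0 ->
  (forall x, ~ N x -> h x = g x) -> Sigma A ->
  u (Linfty_pi hS hsigma hA) = Int (fun x => \1_A x * (g x * sg x)) + mu_p A.
Proof.
move=> [wp pp urep] ig SN N0 hg SA.
have [_ _ ->] := urep (Linfty_pi hS hsigma hA).
have [B [SB B0 fB]] := null_rvar (Linfty_pi_repr hS hsigma hA).
have sA := simple_indic hS SA : simple Sigma (\1_A : T -> R).
congr (_ + _).
  have fhg x : ~ (B `|` N) x -> Linfty_pi hS hsigma hA x * h x = \1_A x * g x.
    move=> /not_orP[nB nN]; rewrite hg//; congr (_ * _).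
    by apply: contrapT => /fB.
  have [_ ->] := integrable_determining hba hm SP hP (salgU hS SB SN)
    (rvarU0 SB SN B0 N0) fhg (integrable_simple_mul sA ig).
  by apply: eq_Int => x; rewrite mulrA.
have dt : determining_seq Sigma mu_p (fun=> \1_A) (Linfty_pi hS hsigma hA).
  apply: (determining_uniform hS wp.1 SB) => //; first exact: rvar_wrt.
  move=> k x nB; rewrite (_ : Linfty_repr _ x = \1_A x) ?subrr ?normr0 ?invr_ge0//.
  by apply: contrapT => /fB.
apply: (mu_integralE hS wp.1 dt); rewrite (sint_indic hS wp.1.1 SA).
exact: cvg_cst.
Qed.

(** Equating the two representations on indicators gives the difference [lam] of the pure parts the
    density [w], so [lam] is countably additive and hence 0. Then [w] integrates to 0 over every set
    and vanishes almost everywhere. *)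
Lemma represents_unique (u : Linfty hS hsigma -> R) mu mu' (h h' : L1 hS hsigma) :
  represents u mu h -> represents u mu' h' ->
  (forall A, Sigma A -> mu' A = mu A) /\ h' = h.
Proof.
move=> rmu rmu'.
have [g [N [ig SN N0 hg]]] := integrable_representative hba hm (L1_val_integrable h).
have [g' [N' [ig' SN' N0' hg']]] :=
  integrable_representative hba hm (L1_val_integrable h').
pose w x : R := (g x - g' x) * sg x.
have iw : integrable w by apply: integrable_mul_sign; exact: integrable_sub.
pose lam A : R := mu' A - mu A.
have [[[amu [M hM]] _] pmu _] := rmu; have [[[amu' [M' hM']] _] pmu' _] := rmu'.
have lamE A : Sigma A -> lam A = Int (fun x => \1_A x * w x).
  move=> SA; have sA := simple_indic hS SA : simple Sigma (\1_A : T -> R).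
  have hA := simple_Linfty_class hS hsigma sA.
  have := represents_ae hA rmu ig SN N0 hg SA.
  rewrite (represents_ae hA rmu' ig' SN' N0' hg' SA) => e.
  rewrite (@eq_Int _ _ _ hS x0 m
    (fun x => \1_A x * (g x * sg x) - \1_A x * (g' x * sg x))).
    rewrite RintegralB//; last 2 first.
    - by apply: integrable_simple_mul => //; exact: integrable_mul_sign.
    - by apply: integrable_simple_mul => //; exact: integrable_mul_sign.
    by rewrite /lam; lra.
  by move=> x; rewrite /w mulrBl mulrBr.
have alam : fin_additive Sigma lam.
  by move=> A B SA SB AB; rewrite /lam amu// amu'// opprD addrACA.
have clam : ca Sigma lam.
  split; first by split => //; exact: countably_additive_density iw lamE.
  exists (M' + M) => A SA; apply: le_trans (ler_normB _ _) _.
  by rewrite lerD ?hM ?hM'.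
have lam0 := pure_sub_sigma_measure hS pmu' pmu clam (fun A _ => erefl).
split; first by move=> A SA; apply/eqP; rewrite -subr_eq0; apply/eqP/lam0.
have /= [] := @integral_ae_eq _ mT R m setT measurableT (cst 0%E) (EFin \o w) iw.
- exact: measurable_cst.
- move=> A _ SA; rewrite integral0.
  have iA : (\int[m]_(x in A) (EFin \o w) x)%E \is a fin_num.
    by apply: integrable_fin_num => //; exact: (integrableS measurableT).
  rewrite -(fineK iA); congr EFin.
  by rewrite -[RHS](lam0 A SA) lamE// Rintegral_indic_mul.
move=> B [SB B0 hB]; apply: L1_ae_eq; exists (N `|` N' `|` B); split.
- by do 2?apply: (salgU hS).
- apply: rvar_null_variation; rewrite rvarU0//; [exact: salgU|exact: rvarU0|].
  by apply/EFin_inj; rewrite -hm.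
- move=> x /= hh; apply: contrapT => /not_orP[/not_orP[nN nN'] nB].
  apply: hh; rewrite [LHS]hg'// [RHS]hg//.
  have wx : w x = 0.
    by apply: contrapT => w0; apply: nB; apply: hB => /= /(_ I) -[].
  (* Multiplying by [sg x], whose square is 1, removes the sign from [w x = 0]. *)
  move: wx; rewrite /w => /(congr1 (fun y => y * sg x)).
  by rewrite -mulrA hahn_sign_sqr mul0r mulr1 => /eqP; rewrite subr_eq0 => /eqP.
Qed.

Section existence.
Variable u : {linear Linfty hS hsigma -> R^o}.
Hypothesis hu : continuous u.

(** [u] read on functions. The default 0 outside the class makes [U] total, so that [U \1_A] is a
    set function on all sets; [UE] frees its values from the proof of membership. *)
Let U f : R := if pselect (Linfty_class Sigma sigma f) is left hf
  then u (Linfty_pi hS hsigma hf) else 0.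

Let UE f (hf : Linfty_class Sigma sigma f) : U f = u (Linfty_pi hS hsigma hf).
Proof.
rewrite /U; case: pselect => // hf'.
by rewrite (Prop_irrelevance hf' hf).
Qed.

Let UD f g : Linfty_class Sigma sigma f -> Linfty_class Sigma sigma g ->
  U (fun x => f x + g x) = U f + U g.
Proof.
move=> hf hg; have hfg := Linfty_classD hS hsigma hf hg.
by rewrite (UE hf) (UE hg) (UE hfg) (Linfty_pi_add u hf hg).
Qed.

Let UZ c f : Linfty_class Sigma sigma f -> U (fun x => c * f x) = c * U f.
Proof.
move=> hf; have hcf := Linfty_classZ hS c hf.
by rewrite (UE hf) (UE hcf) (Linfty_pi_scale u hf).
Qed.

(** Stated for any nonnegative essential bound [M], so no norm has to be computed: [M] is 1 for
    indicators, 0 for indicators of null sets and [1/(k+1)] for approximation errors. *)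
Let U_le : exists2 C : R, 0 <= C & forall f (M : R), Linfty_class Sigma sigma f ->
  0 <= M -> null Sigma sigma [set x | M < `|f x|] -> `|U f| <= C * M.
Proof.
have [C C0 hC] := continuous_Linfty_bounded hu; exists C => // f M hf M0 nM.
rewrite (UE hf); apply: le_trans (hC f hf) _.
by rewrite ler_wpM2l//; exact: ess_norm_le.
Qed.

Let mu A : R := U \1_A.

Let indic_class A : Sigma A -> Linfty_class Sigma sigma (\1_A : T -> R).
Proof. by move=> SA; exact/(simple_Linfty_class hS hsigma)/(simple_indic hS). Qed.

Let amu : fin_additive Sigma mu.
Proof.
move=> A B SA SB AB; rewrite /mu -UD; [|exact: indic_class..].
congr U; apply/funext => x; rewrite !indicE in_setU.
have [/set_mem Ax|_] := boolP (x \in A); have [/set_mem Bx|_] := boolP (x \in B);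
  rewrite ?addr0 ?add0r//.
by have : (A `&` B) x by []; rewrite AB.
Qed.

Let bmu : ba Sigma mu.
Proof.
split; first exact: amu.
have [C C0 hC] := U_le; exists C => A SA; rewrite -[leRHS]mulr1.
apply: hC => //; first exact: indic_class.
apply: null_subset (null_set0 hS hsigma) => x /=.
by rewrite indicE; case: (_ \in _); rewrite ?normr1 ?normr0 ?ltxx// ltr10.
Qed.

Let wmu : ba_wrt Sigma sigma mu.
Proof.
split => // A SA A0; have [C C0 hC] := U_le.
apply/eqP; rewrite -normr_le0 -(mulr0 C); apply: hC => //.
  exact: indic_class.
exists A; split => // x /=; rewrite indicE.
by have [/set_mem//|_] := boolP (x \in A); rewrite normr0 ltxx.
Qed.

Let U_sint s : simple Sigma s -> U s = sint mu s.
Proof.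
apply: (sint_unique hS) => //.
- move=> {}s t hs ht; apply: UD; exact: simple_Linfty_class.
- move=> c {}s hs; apply: UZ; exact: simple_Linfty_class.
Qed.

Lemma represents_ex : exists mu_p h, represents u mu_p h.
Proof.
have cnu := rvar_countably_additive hS x0 hsigma.
have [c [p [[bac cac] bap mucp bnd Z]]] := yosida_hewitt hS bmu anu nu0 cnu.
have mu00 A : Sigma A -> nu A = 0 -> rvar Sigma mu A = 0 by exact: rvar_wrt.
have wp : ba_wrt Sigma sigma p.
  split => // A SA A0; have [_] := bnd A SA; rewrite mu00 ?/rvar ?A0//.
  by rewrite normr_le0 => /eqP.
have c0 A : Sigma A -> nu A = 0 -> c A = 0.
  move=> SA A0; have [+ _] := bnd A SA; rewrite mu00//.
  by rewrite normr_le0 => /eqP.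
have [g ig gE] := radon_nikodym_real (conj bac.1 cac) c0.
have isg := integrable_mul_sign ig.
have nu00 : nu set0 = 0 by exact: (fin_additive0 hS).
(* [h] is the class of [g * sg]: integration against [sigma] brings in a second factor [sg], and
   [sg * sg = 1] leaves the integral of [f * g] against the variation, which is the contribution of
   [c]. *)
have [ih _] := integrable_determining hba hm SP hP (salg0 hS) nu00
  (fun x _ => erefl) isg.
have [h hh] := L1_pi_ex hS hsigma ih.
have [N [SN N0 hN]] := null_rvar hh.
exists p, h; split => //.
  exact: (pure_approx hS x0 hsigma wp).
move=> f; have [mf bf] := Linfty_classP f.
have [ft [B [b [s [[mft ftb] [SB B0] fE ss hs]]]]] := Linfty_approx hba hm mf bf.
have det : determining_seq Sigma p s f.
  apply: (determining_uniform hS bap SB) => //; first exact: rvar_wrt.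
  by move=> k x nB; rewrite fE.
have fhE x : ~ (B `|` N) x -> f x * h x = ft x * (g x * sg x).
  move=> /not_orP[nB nN]; rewrite fE//; congr (_ * _).
  by apply: contrapT => /hN.
have [ifh ->] := integrable_determining hba hm SP hP (salgU hS SB SN)
  (rvarU0 SB SN B0 N0) fhE (integrable_bounded_mul mft ftb isg).
split => //; first by exists s.
(* On simple functions the formula is just [mu = c + p] with [g] as density of [c]; each of the
   three terms then passes to the limit. *)
have sE k : U (s k) = Int (fun x => s k x * g x) + sint p (s k).
  rewrite U_sint// (Rintegral_simple_mul ig gE)// /sint -fsbig_split/=.
    apply: eq_fsbigr => y _; rewrite mucp ?mulrDr//.
    by have [_] := ss k.
  by have [] := ss k.
have UfE : U f = u f by rewrite (UE (Linfty_classP f)) Linfty_reprK.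
have inv0 : (k.+1%:R^-1 : R) @[k --> \oo] --> (0 : R).
  apply/cvgr0Pnorm_lt => e e0; near=> k.
  rewrite ger0_norm ?invr_ge0//; near: k; exact: (near_infty_natSinv_lt (PosNum e0)).
have [C C0 hC] := U_le.
have U_cvg : U (s k) @[k --> \oo] --> u f.
  rewrite -UfE; apply/cvgrPdist_le => e e0.
  have : C * k.+1%:R^-1 @[k --> \oo] --> C * 0 by apply: cvgM => //; exact: cvg_cst.
  rewrite mulr0 => /cvgr0Pnorm_le/(_ e e0); apply: filterS => k.
  rewrite ger0_norm ?mulr_ge0 ?invr_ge0//; apply: le_trans.
  have hsk := simple_Linfty_class hS hsigma (ss k).
  have hNsk := Linfty_classZ hS (-1) hsk.
  (* Written as a sum with a multiple by -1, the difference falls under [UD] and [UZ]; off [B] it is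
     bounded by [1/(k+1)]. *)
  rewrite (_ : U f - U (s k) = U (fun x => f x + (- 1) * s k x)); last first.
    by rewrite (UD (Linfty_classP f) hNsk) UZ// mulN1r.
  apply: hC; first exact: (Linfty_classD hS hsigma (Linfty_classP f) hNsk).
    by rewrite invr_ge0.
  exists B; split => //; first exact: rvar_null_variation.
  move=> x /= hx; apply: contrapT => nB; move: hx.
  by rewrite mulN1r fE// distrC ltNge hs.
have I_cvg : Int (fun x => s k x * g x) @[k --> \oo] --> Int (fun x => ft x * g x).
  have iabs : integrable (fun x => `|g x|) by exact: (integrable_abse ig).
  apply/cvgrPdist_le => e e0.
  have : Int (fun x => `|g x|) * k.+1%:R^-1 @[k --> \oo] --> Int (fun x => `|g x|) * 0.
    by apply: cvgM => //; exact: cvg_cst.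
  rewrite mulr0 => /cvgr0Pnorm_le/(_ e e0); apply: filterS => k.
  rewrite ger0_norm ?mulr_ge0 ?invr_ge0 ?Rintegral_ge0//; apply: le_trans.
  have i1 := integrable_bounded_mul mft ftb ig.
  have i2 := integrable_simple_mul (ss k) ig.
  rewrite -RintegralB//; apply: le_trans (le_normr_Rintegral _ _) _ => //.
    exact: integrable_sub.
  rewrite mulrC -RintegralZl//; apply: le_Int.
  - exact: (integrable_dist i1 i2).
  - exact: (integrableZl measurableT k.+1%:R^-1 iabs).
  - by move=> x; rewrite -mulrBl normrM ler_wpM2r// distrC.
have p_cvg := mu_integral_cvg hS bap det.
rewrite -(cvg_lim (@Rhausdorff R) U_cvg); apply: (cvg_lim (@Rhausdorff R)).
rewrite (@eq_Int _ _ _ hS x0 m (fun x => ft x * g x)); last first.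
  by move=> x; rewrite -!mulrA hahn_sign_sqr mulr1.
under eq_fun do rewrite sE.
exact: cvgD.
Unshelve. all: by end_near. Qed.

End existence.
End inhabited.

Theorem theorem4p14 (R : realType) (n : nat) (Omega : set 'rV[R]_n)
    (Sigma : set (set Omega)) (hSigma : sigma_algebra setT Sigma)
    (sigma : set Omega -> R) (hsigma : sigma_measure Sigma sigma)
    (u : {linear Linfty hSigma hsigma -> R^o}) (hu : continuous u) :
  let represents (mu_p : set Omega -> R) (h : L1 hSigma hsigma) :=
    [/\ ba_wrt Sigma sigma mu_p, pure Sigma mu_p &
        forall f : Linfty hSigma hsigma,
          [/\ mu_integrable Sigma sigma (fun x => f x * h x),
              mu_integrable Sigma mu_p f &
              u f = mu_integral Sigma sigma (fun x => f x * h x)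
                    + mu_integral Sigma mu_p f]] in
  exists (mu_p : set Omega -> R) (h : L1 hSigma hsigma),
    represents mu_p h /\
    forall (mu_p' : set Omega -> R) (h' : L1 hSigma hsigma),
      represents mu_p' h' ->
      (forall A, Sigma A -> mu_p' A = mu_p A) /\ h' = h.
Proof.
have [x0|T0] := pselect (inhabited Omega); last first.
  by apply: represents_empty => x; exact: (T0 (inhabits x)).
case: x0 => x0.
have [m [P [hba SP hm hP]]] := sigma_measure_variation hSigma x0 hsigma.
have [mu_p [h hrep]] := represents_ex hba hm SP hP hu.
exists mu_p, h; split; first exact: hrep.
by move=> mu_p' h' hrep'; exact: (represents_unique hba hm SP hP hrep hrep').
Qed.
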